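(* Let $\Gamma$ be a distance-regular graph with vertex set $X$, diameter $d\geq3$ and classical parameters $(d,b,\alpha,\beta)$ with $b\neq1$ and $\alpha=b-1$. Fix $x\in X$, and let $A,A^*$, $\mathbb T$ and the alternating elements $W_{-k},W_{k+1}$ ($k\in\mathbb N$) of $\mathbb T$ be as in the context. Then every irreducible $\mathbb T$-module $V\subseteq\mathbb R^X$ is the orthogonal direct sum (with respect to $\langle u,v\rangle=u^tv$) of its common eigenspaces for $\{W_{-k}\}_{k\in\mathbb N}$, and also the orthogonal direct sum of its common eigenspaces for $\{W_{k+1}\}_{k\in\mathbb N}$.
   Context: Classical parameters are in the sense of Brouwer–Cohen–Neumaier; here $b$ is an integer with $b\notin\{0,-1,1\}$. Let $\mathbb A$ be the adjacency matrix of $\Gamma$ and $\mathbb A^*=\mathbb A^*(x)$ the dual adjacency matrix with respect to $x$ (for the $Q$-polynomial structure associated with the classical parameters): the diagonal matrix in $\mathrm{Mat}_X(\mathbb R)$ with $(y,y)$-entry $|X|(E_1)_{x,y}$, where $E_1$ is the primitive idempotent of $\mathbb A$ for the eigenvalue $\theta_1$ in that ordering. It is known that there are $r,s\in\mathbb R$, $r\neq0$, such that the roots of the minimal polynomial of $\mathbb A$ and of $\mathbb A^*$ are $rb^{-i}+s$ ($0\le i\le d$). Put $A=\mathbb A-sI$, $A^*=\mathbb A^*-sI$; these are symmetric, and $\mathbb T$ is the subalgebra of $\mathrm{Mat}_X(\mathbb R)$ generated by $A,A^*$. A $\mathbb T$-module is a subspace $V\subseteq\mathbb R^X$ with $\mathbb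 TV\subseteq V$; it is irreducible if nonzero with no $\mathbb T$-submodules other than $0,V$. With $[X,Y]=XY-YX$, $[X,Y]_b=bXY-YX$, the alternating elements of $\mathbb T$ are defined recursively by $W_0=A$, $W_1=A^*$, $G_0=\tilde G_0=I$ and, for $n\geq1$ (in the order $G_1,\tilde G_1,W_{-1},W_2,G_2,\dots$): $G_n=\frac{\sum_{k=0}^{n-1}W_{-k}W_{n-k}b^{-k}-\sum_{k=1}^{n-1}G_k\tilde G_{n-k}b^{-k}}{1+b^{-n}}+\frac{[W_n,W_0]}{(1+b^{-n})(1-b^{-1})}$, $\tilde G_n=G_n+\frac{[W_0,W_n]}{1-b^{-1}}$, $W_{-n}=\frac{[W_0,G_n]_b}{b-1}$, $W_{n+1}=\frac{[G_n,W_1]_b}{b-1}$. *)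

(* Defs.v *)
From mathcomp Require Import all_boot all_order all_algebra.
From mathcomp Require Import falgebra reals zify.

Set Implicit Arguments.
Unset Strict Implicit.
Unset Printing Implicit Defensive.

Import Order.TTheory GRing.Theory Num.Theory.

Local Open Scope ring_scope.

Section Graph.
Variables (X : finType) (e : rel X).

Definition has_walk (k : nat) (x y : X) : bool :=
  [exists p : k.-tuple X, path e x p && (last x p == y)].

(* The length of a shortest walk from x to y; it has at most #|X| - 1 edges, so
   the search below fails (and returns #|X|) only if there is no walk. *)
Definition dist (x y : X) : nat :=
  find (fun k => has_walk k x y) (iota 0 #|X|).

Definition diameter : nat := \max_x \max_y dist x y.

(* c i (resp. b i) counts the neighbours of y at distance i - 1 (resp. i + 1)
   from x, for every pair x, y at distance i. *)
Definition intersection_numbers (c b : nat -> nat) : Prop :=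
  forall x y : X,
    #|[set z | e y z & (dist x z).+1 == dist x y]| = c (dist x y) /\
    #|[set z | e y z & dist x z == (dist x y).+1]| = b (dist x y).

Definition distance_regular : Prop :=
  [/\ symmetric e, irreflexive e, (forall x y, connect e x y)
    & exists c b, intersection_numbers c b].

End Graph.

Section ClassicalParameters.
Variable R : realType.

(* The b-analogue 1 + b + ... + b^(j-1) of j. *)
Definition bnum (b : int) (j : nat) : R := \sum_(0 <= i < j) b%:~R ^+ i.

(* For i = 0 the factor bnum b i.-1 is irrelevant since bnum b 0 = 0. *)
Definition classical_parameters (X : finType) (e : rel X)
    (d : nat) (b : int) (alpha beta : R) : Prop :=
  diameter e = d /\
  exists c' b', intersection_numbers e c' b' /\
    forall i, (i <= d)%N ->
      (b' i)%:R = (bnum b d - bnum b i) * (beta - alpha * bnum b i) /\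
      (c' i)%:R = bnum b i * (1 + alpha * bnum b i.-1).

(* The eigenvalues theta_0, ..., theta_d of the graph, in the Q-polynomial
   ordering attached to the classical parameters (BCN, Corollary 8.4.2). *)
Definition classical_eigenvalue (d : nat) (b : int) (alpha beta : R)
    (i : nat) : R :=
  bnum b (d - i) * (beta - alpha * bnum b i) - bnum b i.

End ClassicalParameters.

Section Matrices.
Variables (R : realType) (n : nat).
Implicit Types M N : 'M[R]_n.+1.

Definition adj_mx (e : rel 'I_n.+1) : 'M[R]_n.+1 :=
  \matrix_(y, z) (e y z)%:R.

(* For symmetric M, the orthogonal projection onto the theta-eigenspace of M:
   kermx U^T is the orthogonal complement of the row space of U, which for
   U = eigenspace M theta is the sum of the other eigenspaces of M. *)
Definition primitive_idempotent M (theta : R) : 'M[R]_n.+1 :=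
  let U := eigenspace M theta in proj_mx U (kermx U^T).

Definition dual_adj_mx (e : rel 'I_n.+1) (d : nat) (b : int) (alpha beta : R)
    (x : 'I_n.+1) : 'M[R]_n.+1 :=
  let E1 := primitive_idempotent (adj_mx e)
              (classical_eigenvalue d b alpha beta 1) in
  diag_mx (\row_y (n.+1%:R * E1 x y)).

Definition generated_algebra M N : {aspace 'M[R]_n.+1} :=
  [aspace of agenv <<[:: M; N]>>%VS].

(* Matrices act on column vectors. *)
Definition is_module (T : {aspace 'M[R]_n.+1}) (V : {vspace 'cV[R]_n.+1}) :
    Prop :=
  forall M v, M \in T -> v \in V -> M *m v \in V.

Definition irreducible_module (T : {aspace 'M[R]_n.+1})
    (V : {vspace 'cV[R]_n.+1}) : Prop :=
  [/\ is_module T V, V <> 0%VS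
    & forall U : {vspace 'cV[R]_n.+1},
        is_module T U -> (U <= V)%VS -> U = 0%VS \/ U = V].

Definition common_eigenspace (F : nat -> 'M[R]_n.+1)
    (V U : {vspace 'cV[R]_n.+1}) : Prop :=
  U <> 0%VS /\
  exists lambda : nat -> R, forall v : 'cV[R]_n.+1,
    v \in U <-> v \in V /\ forall k, F k *m v = lambda k *: v.

Definition orthogonal_vspaces (U V : {vspace 'cV[R]_n.+1}) : Prop :=
  forall u v, u \in U -> v \in V -> u^T *m v = 0.

Definition orthogonal_sum_of_common_eigenspaces (F : nat -> 'M[R]_n.+1)
    (V : {vspace 'cV[R]_n.+1}) : Prop :=
  exists S : seq {vspace 'cV[R]_n.+1},
    [/\ uniq S,
        (forall U, U \in S <-> common_eigenspace F V U),
        V = (\sum_(U <- S) U)%VS,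
        directv (\sum_(U <- S) U)%VS
      & forall U1 U2, U1 \in S -> U2 \in S -> U1 <> U2 ->
          orthogonal_vspaces U1 U2].

Definition comm_mx2 M N : 'M[R]_n.+1 := M * N - N * M.

Definition qcomm_mx2 (q : R) M N : 'M[R]_n.+1 := q *: (M * N) - N * M.

(* W_j for j in Z, and G_k, G~_k for k in N (H stands for G~). *)
Record alternating_family := AlternatingFamily {
  altW_of : int -> 'M[R]_n.+1;
  altG_of : nat -> 'M[R]_n.+1;
  altH_of : nat -> 'M[R]_n.+1
}.

(* The family at stage m holds the final values of W_j for -m <= j <= m + 1 and
   of G_k, G~_k for k <= m; the other entries are placeholders. *)
Fixpoint alternating_stage (q : R) (A As : 'M[R]_n.+1) (m : nat) :
    alternating_family :=
  match m with
  | 0%N =>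
      AlternatingFamily
        (fun j => if j == 0 then A else if j == 1 then As else 0)
        (fun k => if k == 0%N then 1 else 0)
        (fun k => if k == 0%N then 1 else 0)
  | m'.+1 =>
      let: AlternatingFamily W G Ht := alternating_stage q A As m' in
      let Gm :=
        (1 + q ^- m)^-1 *:
          (\sum_(0 <= k < m) q ^- k *: (W (- k%:Z) * W (m%:Z - k%:Z))
           - \sum_(1 <= k < m) q ^- k *: (G k * Ht (m - k)%N))
        + ((1 + q ^- m) * (1 - q^-1))^-1 *: comm_mx2 (W m%:Z) (W 0) in
      let Htm := Gm + (1 - q^-1)^-1 *: comm_mx2 (W 0) (W m%:Z) in
      AlternatingFamily
        (fun j => if j == - m%:Z then (q - 1)^-1 *: qcomm_mx2 q (W 0) Gm
                  else if j == m.+1%:Z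
                       then (q - 1)^-1 *: qcomm_mx2 q Gm (W 1)
                  else W j)
        (fun k => if k == m then Gm else G k)
        (fun k => if k == m then Htm else Ht k)
  end.

Definition altW (q : R) (A As : 'M[R]_n.+1) (j : int) : 'M[R]_n.+1 :=
  altW_of (alternating_stage q A As `|j|%N) j.

Definition altG (q : R) (A As : 'M[R]_n.+1) (k : nat) : 'M[R]_n.+1 :=
  altG_of (alternating_stage q A As k) k.

Definition altH (q : R) (A As : 'M[R]_n.+1) (k : nat) : 'M[R]_n.+1 :=
  altH_of (alternating_stage q A As k) k.

Section Recursion.
Variables (q : R) (A As : 'M[R]_n.+1).
Notation W := (altW q A As).
Notation G := (altG q A As).
Notation Ht := (altH q A As).
Notation stage := (alternating_stage q A As).

Lemma altW0 : W 0 = A. Proof. by []. Qed.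
Lemma altG0 : G 0%N = 1. Proof. by []. Qed.
Lemma altH0 : Ht 0%N = 1. Proof. by []. Qed.

Lemma altW_ofS m j : j <> - m.+1%:Z -> j <> m.+2%:Z ->
  altW_of (stage m.+1) j = altW_of (stage m) j.
Proof.
by move=> /eqP/negPf j1 /eqP/negPf j2 /=; case: (stage m) => *; rewrite /= j1 j2.
Qed.

Lemma altW_stageN m k : (k <= m)%N -> altW_of (stage m) (- k%:Z) = W (- k%:Z).
Proof.
rewrite /altW abszN absz_nat; elim: m => [|m IHm]; first by case: k.
rewrite leq_eqVlt => /predU1P[-> //|]; rewrite ltnS => lekm.
by rewrite altW_ofS ?IHm //; lia.
Qed.

Lemma altW_stageS m k : (k <= m)%N -> altW_of (stage m) k.+1%:Z = W k.+1%:Z.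
Proof.
have base l : altW_of (stage l.+1) l.+1%:Z = altW_of (stage l) l.+1%:Z.
  by rewrite altW_ofS //; lia.
rewrite /altW absz_nat base; elim: m => [|m IHm]; first by case: k.
rewrite leq_eqVlt => /predU1P[-> //|]; rewrite ltnS => lekm.
by rewrite altW_ofS ?IHm //; lia.
Qed.

Lemma altG_stage m k : (k <= m)%N -> altG_of (stage m) k = G k.
Proof.
elim: m => [|m IHm]; first by case: k.
rewrite leq_eqVlt => /predU1P[-> //|]; rewrite ltnS => lekm.
rewrite -IHm //=; case: (stage m) => *.
by rewrite /= ltn_eqF.
Qed.

Lemma altH_stage m k : (k <= m)%N -> altH_of (stage m) k = Ht k.
Proof.
elim: m => [|m IHm]; first by case: k.
rewrite leq_eqVlt => /predU1P[-> //|]; rewrite ltnS => lekm.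
rewrite -IHm //=; case: (stage m) => *.
by rewrite /= ltn_eqF.
Qed.

Lemma altW1 : W 1 = As.
Proof. by rewrite -(@altW_stageS 0 0). Qed.

Lemma altGE m : (0 < m)%N ->
  G m = (1 + q ^- m)^-1 *:
          (\sum_(0 <= k < m) q ^- k *: (W (- k%:Z) * W (m%:Z - k%:Z))
           - \sum_(1 <= k < m) q ^- k *: (G k * Ht (m - k)%N))
        + ((1 + q ^- m) * (1 - q^-1))^-1 *: comm_mx2 (W m%:Z) (W 0).
Proof.
case: m => // m _; rewrite {1}/altG.
have EW0 := @altW_stageN m 0 isT; have EWm := @altW_stageS m m (leqnn m).
have EWN k : (k <= m)%N -> altW_of (stage m) (- k%:Z) = W (- k%:Z).
  exact: altW_stageN.
have EWP k : (k <= m)%N ->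
    altW_of (stage m) (m.+1%:Z - k%:Z) = W (m.+1%:Z - k%:Z).
  move=> lekm; have -> : m.+1%:Z - k%:Z = (m - k).+1%:Z by lia.
  by apply: altW_stageS; lia.
have EG k : (k <= m)%N -> altG_of (stage m) k = G k by exact: altG_stage.
have EHt k : (k <= m)%N -> altH_of (stage m) k = Ht k by exact: altH_stage.
move: EW0 EWm EWN EWP EG EHt => /=; case: (stage m) => W' G' Ht' /=.
rewrite oppr0 eqxx => -> -> EWN EWP EG EHt.
congr (_ *: (_ - _) + _); apply: eq_big_nat => k /andP[k0 km].
  by rewrite EWN ?EWP.
by rewrite EG ?EHt //; lia.
Qed.

Lemma altHE m : (0 < m)%N ->
  Ht m = G m + (1 - q^-1)^-1 *: comm_mx2 (W 0) (W m%:Z).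
Proof.
case: m => // m _; rewrite /altG /altH.
have EW0 := @altW_stageN m 0 isT; have EWm := @altW_stageS m m (leqnn m).
move: EW0 EWm => /=; case: (stage m) => W' G' Ht' /=.
by rewrite oppr0 eqxx => <- <-.
Qed.

Lemma altWNE m : (0 < m)%N ->
  W (- m%:Z) = (q - 1)^-1 *: qcomm_mx2 q (W 0) (G m).
Proof.
case: m => // m _; rewrite /altG.
rewrite -(@altW_stageN m.+1) //.
have EW0 := @altW_stageN m 0 isT.
move: EW0 => /=; case: (stage m) => W' G' Ht' /=.
by rewrite oppr0 !eqxx => <-.
Qed.

Lemma altWSE m : (0 < m)%N ->
  W m.+1%:Z = (q - 1)^-1 *: qcomm_mx2 q (G m) (W 1).
Proof.
case: m => // m _; rewrite /altG.
rewrite -(@altW_stageS m.+1) //.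
have EW1 := @altW_stageS m 0 isT.
move: EW1 => /=; case: (stage m) => W' G' Ht' /=.
by rewrite !eqxx => <-.
Qed.

End Recursion.

End Matrices.

(* Main.v *)
(* A and A* satisfy the q-Serre relations: the Q-polynomial structure gives
   E_i A* E_j = 0 and E*_i A E*_j = 0 for |i - j| > 1, and the eigenvalues r b^-i
   make the q-Serre polynomial vanish when |i - j| <= 1.

   In an algebra where q-Serre holds, put z = AB - bBA and let x_k, y_k be obtained
   from A, B by applying +-ad z repeatedly (up to scale). Then x_i y_j - b y_j x_i
   depends only on i + j; these elements f_(i+j), suitably scaled, form with 1 a
   series P(t) whose coefficients commute: their commutators on a fixed level obey
   a Chebyshev recursion whose two ends contradict each other. Let G(t) be the
   series with P(t) G(t) G(t/b) = 1. With X(t), Y(t) the series of the x_k, y_k,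
   the series X G, G Y, G and G (P + t X(bt) Y) satisfy the recursion of the
   alternating elements, so they are W^-, W^+, G and G~. Both the q-determinant
   relation of the recursion and its mirror image hold, so transposition fixes
   the W's and exchanges G and G~. The G_k commute with each other, and commuting
   A twice past [G_k, G_l] = 0 yields [W_-k, W_-l] = 0; the case of the W_(k+1) is
   dual. Finally a commuting family of real symmetric matrices preserving V
   splits V orthogonally into common eigenspaces. *)

(* The q-Serre algebra is the positive part of quantum affine sl_2. Since only matrices satisfying
   its relations are at hand, no basis of that algebra can be used, and all commutation has to be
   extracted from the relations themselves. The series G is a twisted square root of the inverse of
   P. Its uniqueness, due to b^k <> -1, carries commutation relations from P, where they are
   explicit, over to G. On the graph side the Q-polynomial property is derived: for alpha = b - 1
   the matrices with entries b^(-l dist) form a flag on which the adjacency matrix is triangular, so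
   each idempotent E_i is entrywise a polynomial of degree at most i in b^(-dist). The numbers r and
   s are given only through a set of roots. Matching them with the computed eigenvalues is an
   arithmetic problem on powers of the integer b, and there the diameter bound 3 is essential. *)
Require Import Defs.
From HB Require Import structures.
From mathcomp Require Import all_boot all_order all_algebra.
From mathcomp Require Import falgebra reals.
From mathcomp Require Import boolp complex ring zify.

Set Implicit Arguments.
Unset Strict Implicit.
Unset Printing Implicit Defensive.

Import Order.TTheory GRing.Theory Num.Theory.
Local Open Scope ring_scope.

(* Reflexive normalisation of noncommutative polynomials with scalar
   coefficients: an identity holds if, after grouping equal monomials, every
   coefficient vanishes. *)
Section NcNormalisation.
Variables (S : comNzRingType) (V : algType S).

Inductive ncexpr : Type :=
| NcVar of nat | NcZero | NcOne | NcAdd of ncexpr & ncexpr | NcOpp of ncexpr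
| NcMul of ncexpr & ncexpr | NcScale of S & ncexpr.

Variable env : nat -> V.

Fixpoint nc_eval (e : ncexpr) : V :=
  match e with
  | NcVar k => env k
  | NcZero => 0
  | NcOne => 1
  | NcAdd e1 e2 => nc_eval e1 + nc_eval e2
  | NcOpp e1 => - nc_eval e1
  | NcMul e1 e2 => nc_eval e1 * nc_eval e2
  | NcScale c e1 => c *: nc_eval e1
  end.

(** Private copies of list functions: the [cbv] of [nc_start] unfolds exactly these names and leaves
    the scalars of the goal untouched. *)
Fixpoint nc_cat T (u v : list T) : list T :=
  match u with nil => v | cons x u' => cons x (nc_cat u' v) end.

Fixpoint nc_map T U (f : T -> U) (u : list T) : list U :=
  match u with nil => nil | cons x u' => cons (f x) (nc_map f u') end.

Fixpoint nc_eqn (m n : nat) : bool :=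
  match m, n with
  | O, O => true | Datatypes.S m', Datatypes.S n' => nc_eqn m' n'
  | _, _ => false
  end.

Fixpoint nc_eqw (u v : list nat) : bool :=
  match u, v with
  | nil, nil => true
  | cons x u', cons y v' => if nc_eqn x y then nc_eqw u' v' else false
  | _, _ => false
  end.

Fixpoint nc_mul1 (c : S) (w : list nat) (l : list (S * list nat)) :=
  match l with
  | nil => nil
  | cons (pair d v) l' => cons (pair (c * d) (nc_cat w v)) (nc_mul1 c w l')
  end.

Fixpoint nc_mul (l1 l2 : list (S * list nat)) :=
  match l1 with
  | nil => nil
  | cons (pair c w) l' => nc_cat (nc_mul1 c w l2) (nc_mul l' l2)
  end.

Fixpoint nc_norm (e : ncexpr) : list (S * list nat) :=
  match e with
  | NcVar k => cons (pair 1 (cons k nil)) nil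
  | NcZero => nil
  | NcOne => cons (pair 1 nil) nil
  | NcAdd e1 e2 => nc_cat (nc_norm e1) (nc_norm e2)
  | NcOpp e1 => nc_mul1 (- 1) nil (nc_norm e1)
  | NcMul e1 e2 => nc_mul (nc_norm e1) (nc_norm e2)
  | NcScale c e1 => nc_mul1 c nil (nc_norm e1)
  end.

Fixpoint nc_insert (c : S) (w : list nat) (l : list (S * list nat)) :=
  match l with
  | nil => cons (pair c w) nil
  | cons (pair d v) l' => if nc_eqw w v then cons (pair (d + c) v) l'
                         else cons (pair d v) (nc_insert c w l')
  end.

Fixpoint nc_group (l acc : list (S * list nat)) :=
  match l with
  | nil => acc
  | cons (pair c w) l' => nc_group l' (nc_insert c w acc)
  end.

Fixpoint nc_zero (l : list (S * list nat)) : Prop :=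
  match l with
  | nil => True
  | cons (pair c _) l' => c = 0 /\ nc_zero l'
  end.

Definition nc_word (w : list nat) : V := foldr (fun k v => env k * v) 1 w.
Definition nc_sum (l : list (S * list nat)) : V :=
  foldr (fun p v => p.1 *: nc_word p.2 + v) 0 l.

Lemma nc_wordM u v : nc_word (nc_cat u v) = nc_word u * nc_word v.
Proof. by elim: u => [|k u IH] /=; rewrite ?mul1r ?IH ?mulrA. Qed.

Lemma nc_sumD l1 l2 : nc_sum (nc_cat l1 l2) = nc_sum l1 + nc_sum l2.
Proof. by elim: l1 => [|p l1 IH] /=; rewrite ?add0r ?IH ?addrA. Qed.

Lemma nc_sum_mul1 c w l : nc_sum (nc_mul1 c w l) = c *: (nc_word w * nc_sum l).
Proof.
elim: l => [|[d v] l IH] /=; first by rewrite mulr0 scaler0.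
by rewrite IH nc_wordM mulrDr scalerDr -scalerAr scalerA.
Qed.

Lemma nc_sumM l1 l2 : nc_sum (nc_mul l1 l2) = nc_sum l1 * nc_sum l2.
Proof.
elim: l1 => [|[c w] l1 IH] /=; first by rewrite mul0r.
by rewrite nc_sumD IH nc_sum_mul1 mulrDl scalerAl.
Qed.

Lemma nc_normE e : nc_sum (nc_norm e) = nc_eval e.
Proof.
elim: e => [k|||e1 IH1 e2 IH2|e1 IH1|e1 IH1 e2 IH2|c e1 IH1] /=.
- by rewrite mulr1 scale1r addr0.
- by [].
- by rewrite scale1r addr0.
- by rewrite nc_sumD IH1 IH2.
- by rewrite nc_sum_mul1 IH1 mul1r scaleN1r.
- by rewrite nc_sumM IH1 IH2.
- by rewrite nc_sum_mul1 IH1 mul1r.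
Qed.

Lemma nc_eqwP u v : nc_eqw u v -> u = v.
Proof.
have eqnP m k : nc_eqn m k -> m = k.
  by elim: m k => [|m IH] [|k] //= /IH ->.
by elim: u v => [|x u IH] [|y v] //=; case: ifP => // /eqnP -> /IH ->.
Qed.

Lemma nc_insertE c w l : nc_sum (nc_insert c w l) = c *: nc_word w + nc_sum l.
Proof.
elim: l => [|[d v] l IH] //=; case: ifP => [/nc_eqwP ->|_] /=.
  by rewrite scalerDl addrA [_ + c *: _]addrC.
by rewrite IH addrCA.
Qed.

Lemma nc_groupE l acc : nc_sum (nc_group l acc) = nc_sum l + nc_sum acc.
Proof.
elim: l acc => [|[c w] l IH] acc /=; first by rewrite add0r.
by rewrite IH nc_insertE addrCA addrA.
Qed.

Lemma nc_zeroE l : nc_zero l -> nc_sum l = 0.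
Proof.
by elim: l => [|[c w] l IH] //= [-> /IH ->]; rewrite scale0r addr0.
Qed.

Lemma nc_correct e1 e2 :
  nc_zero (nc_group (nc_norm (NcAdd e1 (NcOpp e2))) nil) ->
  nc_eval e1 = nc_eval e2.
Proof.
move=> /nc_zeroE; rewrite nc_groupE addr0 nc_normE /= => e.
by apply/subr0_eq.
Qed.

End NcNormalisation.

(** * Reification tactics for noncommutative identities *)

Ltac nc_mem x l :=
  match l with
  | nil => constr:(false)
  | cons x _ => constr:(true)
  | cons _ ?l' => nc_mem x l'
  end.

Ltac nc_index x l :=
  match l with
  | cons x _ => constr:(O)
  | cons _ ?l' => let k := nc_index x l' in constr:(Datatypes.S k)
  end.

Ltac nc_atoms t l :=
  match t with
  | 0 => l
  | 1 => l
  | ?a + ?b => let l' := nc_atoms a l in nc_atoms b l'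
  | - ?a => nc_atoms a l
  | ?a * ?b => let l' := nc_atoms a l in nc_atoms b l'
  | _ *: ?a => nc_atoms a l
  | _ => match nc_mem t l with
         | true => l
         | false => constr:(cons t l)
         end
  end.

Ltac nc_reify S t l :=
  match t with
  | 0 => constr:(@NcZero S)
  | 1 => constr:(@NcOne S)
  | ?a + ?b => let a' := nc_reify S a l in let b' := nc_reify S b l in
               constr:(@NcAdd S a' b')
  | - ?a => let a' := nc_reify S a l in constr:(@NcOpp S a')
  | ?a * ?b => let a' := nc_reify S a l in let b' := nc_reify S b l in
               constr:(@NcMul S a' b')
  | ?c *: ?a => let a' := nc_reify S a l in constr:(@NcScale S c a')
  | _ => let k := nc_index t l in constr:(@NcVar S k)
  end.

Ltac nc_start :=
  lazymatch goal with
  | |- @eq ?T ?u ?v =>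
      let T' := eval hnf in T in
      lazymatch T' with matrix ?S0 (Datatypes.S ?n) _ =>
      let S := constr:(S0 : comNzRingType) in
      let V := constr:('M[S]_n.+1) in
      let l0 := constr:(@nil V) in
      let l1 := nc_atoms u l0 in
      let l := nc_atoms v l1 in
      let e1 := nc_reify S u l in
      let e2 := nc_reify S v l in
      let env := constr:(fun k : nat => nth (0 : V) l k) in
      refine (@nc_correct S V env e1 e2 _);
      cbv [nc_zero nc_group nc_norm nc_insert nc_mul nc_mul1 nc_cat nc_eqw
           nc_eqn];
      repeat (split; [|]); try exact I
      end
  end.

Ltac ncring := nc_start; ring.
Ltac ncfield := nc_start; field.
Tactic Notation "ncring" ":" constr(e) := nc_start; ring: e.

Definition br (S : comNzRingType) n (M N : 'M[S]_n.+1) := M * N - N * M.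

(** * A three-term recursion for q not a root of unity *)

Section NotRootOfUnity.
Variables (F : numFieldType) (q : F).
Hypotheses (q0 : q != 0) (qnr : forall k, (0 < k)%N -> q ^+ k != 1).

Lemma exprq_neqN1 k : (0 < k)%N -> q ^+ k != -1.
Proof.
move=> k0; apply/eqP => e.
have := @qnr (k * 2)%N; rewrite muln_gt0 k0 exprM e => /(_ isT).
by rewrite sqrrN expr1n eqxx.
Qed.

Lemma q_sub1_neq0 : q - 1 != 0.
Proof. by rewrite subr_eq0 -[q]expr1 qnr. Qed.

Lemma q_add1_neq0 : q + 1 != 0.
Proof. by rewrite addr_eq0 -[q]expr1 exprq_neqN1. Qed.

Lemma q_subV_neq0 : q - q^-1 != 0.
Proof.
have -> : q - q^-1 = (q - 1) * (q + 1) / q by field.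
by rewrite !mulf_neq0 ?invr_neq0 ?q_sub1_neq0 ?q_add1_neq0.
Qed.

(* The recursion is that of the numbers [m] = (q^m - q^-m) / (q - q^-1), and
   [N] <> -1. *)
Lemma chebyshev_zero n (K : nat -> 'M[F]_n.+1) N : (1 < N)%N ->
  K 0%N = 0 ->
  (forall m, (1 <= m < N)%N -> K m.+1 = (q + q^-1) *: K m - K m.-1) ->
  K N = - K 1%N -> forall m, (m <= N)%N -> K m = 0.
Proof.
move=> N1 K0 rec KN.
have KE m : (m < N)%N ->
    (q - q^-1) *: K m = (q ^+ m - q ^- m) *: K 1%N /\
    (q - q^-1) *: K m.+1 = (q ^+ m.+1 - q ^- m.+1) *: K 1%N.
  elim: m => [|m IHm] mN; first by rewrite K0 expr0 invr1 subrr scale0r scaler0.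
  have [IH1 IH2] := IHm (ltnW mN); split => //.
  rewrite rec //= scalerBr scalerA [_ * (_ + _)]mulrC -scalerA IH2 IH1 scalerA.
  rewrite -scalerBl; congr (_ *: _).
  rewrite !exprS; field.
  by rewrite q0 expf_neq0.
have e1 : (q ^+ N - q ^- N + (q - q^-1)) *: K 1%N = 0.
  have [_] := KE N.-1 ltac:(lia); rewrite prednK; last by lia.
  by rewrite KN scalerN => h; rewrite scalerDl -h addNr.
have K1 : K 1%N = 0.
  move/eqP: e1; rewrite scaler_eq0 => /orP[|/eqP//].
  have -> : q ^+ N - q ^- N + (q - q^-1) =
            (q ^+ N.-1 + 1) * (q ^+ N.+1 - 1) / q ^+ N.
    have -> : q ^+ N = q ^+ N.-1 * q by rewrite -exprSr prednK //; lia.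
    have -> : q ^+ N.+1 = q ^+ N.-1 * q * q by rewrite -!exprSr prednK //; lia.
    by field; rewrite q0 expf_neq0.
  rewrite !mulf_eq0 invr_eq0 expf_eq0 (negPf q0) andbF orbF addr_eq0 subr_eq0.
  by rewrite (negPf (@exprq_neqN1 N.-1 _)) ?(negPf (@qnr N.+1 _)) //; lia.
move=> m mN; apply/eqP.
have : (q - q^-1) *: K m = 0.
  case: m mN => [|m] mN; first by rewrite K0 scaler0.
  by have [_ ->] := KE m mN; rewrite K1 scaler0.
by move/eqP; rewrite scaler_eq0 (negPf q_subV_neq0).
Qed.

End NotRootOfUnity.

(** * Root vectors of the q-Serre algebra *)

Section DrinfeldIdentities.
Variables (F : numFieldType) (q : F) (n : nat).
Hypothesis q0 : q != 0.
Implicit Types X Y P : 'M[F]_n.+1.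

Definition qc X Y := X * Y - q *: (Y * X).

(** Used with [X0 = A], [X1 = xs 1], [Y = ys m]: the Serre relation becomes a formula for the
    commutator of f_(m+1) with A. *)
Lemma qc_brx X0 X1 Y : X1 * X0 = q *: (X0 * X1) ->
  br (qc X1 Y) X0 = q *: (qc X0 Y * X1) - q^-1 *: (X1 * qc X0 Y).
Proof.
move/eqP; rewrite -subr_eq0 => /eqP H; apply/subr0_eq.
set D := _ - _ in H.
(* A certificate: the difference of the two sides is a combination of multiples of the relation [D].
   Most algebraic identities below are proved in this way. *)
transitivity (q^-1 *: (D * Y) - q *: (Y * D)).
  by rewrite /D /br /qc; ncfield.
by rewrite H mul0r mulr0 !scaler0 subr0.
Qed.

Lemma qc_bry X Y0 Y1 : Y0 * Y1 = q *: (Y1 * Y0) ->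
  br (qc X Y1) Y0 = q^-1 *: (qc X Y0 * Y1) - q *: (Y1 * qc X Y0).
Proof.
move/eqP; rewrite -subr_eq0 => /eqP H; apply/subr0_eq.
set D := _ - _ in H.
transitivity (q *: (D * X) - q^-1 *: (X * D)).
  by rewrite /D /br /qc; ncfield.
by rewrite H mul0r mulr0 !scaler0 subr0.
Qed.

(** The product rule for the bracket with [P2], in which the primes stand for a shift of index; the
    equality of the two mixed q-commutators absorbs the terms left over. *)
Lemma br_qc_rec P0 P1 P2 X X' Y Y' :
  br P2 X = q *: (P1 * X') - q^-1 *: (X' * P1) ->
  br P2 Y = q^-1 *: (P1 * Y') - q *: (Y' * P1) ->
  br P1 X = q *: (P0 * X') - q^-1 *: (X' * P0) ->
  br P1 Y = q^-1 *: (P0 * Y') - q *: (Y' * P0) ->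
  qc X' Y = qc X Y' ->
  br P2 (qc X Y) = q *: br P1 (qc X' Y) + q^-1 *: br P1 (qc X Y')
                   - br P0 (qc X' Y').
Proof.
(* Puts each hypothesis into the form u - v = 0, so that it can serve in a certificate. *)
pose H (u v : 'M[F]_n.+1) (e : u = v) := etrans (congr1 (+%R^~ (- v)) e) (subrr v).
move=> /H + /H + /H + /H + /H; rewrite /=.
set D1 := _ - _; set D2 := _ - _; set D3 := _ - _; set D4 := _ - _.
set D5 := _ - _; move=> e1 e2 e3 e4 e5; apply/subr0_eq.
transitivity (D1 * Y + X * D2 - q *: (D2 * X) - q *: (Y * D1)
  + q ^+ 2 *: (D4 * X') - q^-1 *: (X' * D4)
  - q^-1 *: (D3 * Y') + q ^+ 2 *: (Y' * D3) + (q - q^-1) *: (D5 * P1)).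
  rewrite /D1 /D2 /D3 /D4 /D5 /br /qc.
  by ncfield.
by rewrite e1 e2 e3 e4 e5 !(mul0r, mulr0, scaler0, subr0, addr0).
Qed.

End DrinfeldIdentities.

Lemma br_antisym (S : comNzRingType) n (M N : 'M[S]_n.+1) : br N M = - br M N.
Proof. by rewrite /br opprB. Qed.

Section RootVectors.
Variables (F : numFieldType) (q : F).
Hypotheses (q0 : q != 0) (qnr : forall k, (0 < k)%N -> q ^+ k != 1).
Variables (n : nat) (A B : 'M[F]_n.+1).

Let q1 : q - 1 != 0. Proof. exact: q_sub1_neq0. Qed.
Let qV : q - q^-1 != 0. Proof. exact: q_subV_neq0. Qed.
(* Up to scalars, xs k and ys k are Damiani's real root vectors E_{k delta + alpha_0}
   and E_{k delta + alpha_1}, and fs k is the imaginary root vector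
   E_{(k+1) delta}. *)
Definition kap : F := ((q - 1) * (q - q^-1))^-1.
Definition dz (M : 'M[F]_n.+1) := kap *: br (qc q A B) M.
Definition xs k := iter k dz A.
Definition ys k := iter k (fun M => - dz M) B.
Definition fs k := qc q A (ys k).
Definition ps k : 'M[F]_n.+1 := if k is k'.+1 then (q - 1)^-1 *: fs k' else 1.

Hypothesis serreA : xs 1 * A = q *: (A * xs 1).
Hypothesis serreB : B * ys 1 = q *: (ys 1 * B).

(** [dz] is a derivation; the minus sign is the one built into [ys]. *)
Lemma dz_qc i j : dz (qc q (xs i) (ys j)) =
  qc q (xs i.+1) (ys j) - qc q (xs i) (ys j.+1).
Proof.
rewrite /xs /ys !iterS -/(xs i) -/(ys j) /dz.
by move: (xs i) (ys j) (qc q A B) kap => X Y Z k; rewrite /br /qc; ncring.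
Qed.

Lemma dzM M N : dz (M * N) = dz M * N + M * dz N.
Proof. by rewrite /dz; move: (qc q A B) => Z; rewrite /br; ncring. Qed.

Lemma dzB M N : dz (M - N) = dz M - dz N.
Proof. by rewrite /dz; move: (qc q A B) => Z; rewrite /br; ncring. Qed.

Lemma dzZ c M : dz (c *: M) = c *: dz M.
Proof. by rewrite /dz; move: (qc q A B) => Z; rewrite /br; ncring. Qed.

Lemma fsE k : fs k = (q - 1) *: ps k.+1.
Proof. by rewrite /= scalerA divff // scale1r. Qed.

Lemma dzE M : dz M = (q - q^-1)^-1 *: br (ps 1) M.
Proof.
rewrite /dz /kap /ps /fs /=; move: (qc q A B) => Z.
by rewrite /br; ncfield; rewrite q1 q0 -expr2 subr_eq0 qnr.
Qed.

Lemma br_ps1_xs i : br (ps 1) (xs i) = (q - q^-1) *: xs i.+1.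
Proof. by rewrite /= dzE scalerA divff ?scale1r. Qed.

Lemma br_ps1_ys i : br (ps 1) (ys i) = (q^-1 - q) *: ys i.+1.
Proof.
by rewrite /= dzE scalerN scalerA -(opprB q) mulNr divff // scaleN1r opprK.
Qed.

(** Induction hypothesis of [br_ps]: commutation is proved level by level in k + l, so the formulas
    leading to it hold only below the level already reached. *)
Let com N := forall k l, (k + l <= N)%N -> br (ps k) (ps l) = 0.

(** [dz] is a multiple of the bracket with p_1, hence kills f_(i+j) below level N; [dz_qc] then lets
    one unit pass from j to i. *)
Lemma qc_xs_ys N : com N -> forall i j, (i + j < N)%N ->
  qc q (xs i) (ys j) = fs (i + j).
Proof.
move=> cN; elim=> [|i IH] j ijN; first by rewrite add0n.
have := dz_qc i j; rewrite IH; last by lia.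
rewrite fsE dzZ dzE cN ?scaler0; last by lia.
move=> /esym/eqP; rewrite subr_eq0 IH; last by lia.
by rewrite addSnnS => /eqP.
Qed.

Lemma br_ps_xs0 N m : com N -> (m < N)%N ->
  br (ps m.+1) A = q *: (ps m * xs 1) - q^-1 *: (xs 1 * ps m).
Proof.
case: m => [|m] cN mN.
  by rewrite -[A]/(xs 0) br_ps1_xs /= mulr1 mul1r scalerBl.
have := @qc_brx F q n q0 A (xs 1) (ys m) serreA.
rewrite (@qc_xs_ys N cN 1%N) ?add1n // -[A]/(xs 0).
rewrite (@qc_xs_ys N cN 0%N) ?(ltnW mN) //.
rewrite /ps -/fs; move: (fs m) (fs m.+1) (xs 0) (xs 1) => f0 f1 X0 X1 e.
transitivity ((q - 1)^-1 *: br f1 X0); first by rewrite /br; ncring.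
by rewrite e; ncring.
Qed.

Lemma br_ps_ys0 N m : com N -> (m < N)%N ->
  br (ps m.+1) B = q^-1 *: (ps m * ys 1) - q *: (ys 1 * ps m).
Proof.
case: m => [|m] cN mN.
  by rewrite -[B]/(ys 0) br_ps1_ys /= mulr1 mul1r scalerBl.
have := @qc_bry F q n q0 (xs m) B (ys 1) serreB.
rewrite (@qc_xs_ys N cN m 1%N) ?addn1 // -[B]/(ys 0).
rewrite (@qc_xs_ys N cN m 0%N) ?addn0 ?(ltnW mN) //.
rewrite /ps -/fs; move: (fs m) (fs m.+1) (ys 0) (ys 1) => f0 f1 X0 X1 e.
transitivity ((q - 1)^-1 *: br f1 X0); first by rewrite /br; ncring.
by rewrite e; ncring.
Qed.

(** Apply [dz] repeatedly to the case i = 0: it raises the index of x and kills p_m and p_(m+1). For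
    the latter, level m + 2 must already be known. *)
Lemma br_ps_xs N m i : com N -> (m < N)%N -> (i == 0%N) || (m.+1 < N)%N ->
  br (ps m.+1) (xs i) = q *: (ps m * xs i.+1) - q^-1 *: (xs i.+1 * ps m).
Proof.
move=> cN mN; elim: i => [|i IH] imN; first exact: br_ps_xs0 cN mN.
have {}IH := IH (introT orP (or_intror imN)).
have c1 : dz (ps m.+1) = 0 by rewrite dzE cN ?scaler0 //; lia.
have c2 : dz (ps m) = 0 by rewrite dzE cN ?scaler0 //; lia.
have -> : xs i.+2 = dz (xs i.+1) by [].
have -> : xs i.+1 = dz (xs i) by [].
have := congr1 dz IH; rewrite -[xs i.+1]/(dz (xs i)).
move: (ps m) (ps m.+1) (xs i) c1 c2 => P P' X c1 c2.
by rewrite /br !(dzB, dzZ, dzM) c1 c2 !(mul0r, mulr0, add0r, addr0).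
Qed.

Lemma br_ps_rec N m l : com N -> (0 < m)%N -> (m + l.+2 = N.+1)%N ->
  br (ps m.+1) (ps l.+1) =
  (q + q^-1) *: br (ps m) (ps l.+2) - br (ps m.-1) (ps l.+3).
Proof.
case: m => // m cN _ mlN; rewrite succnK.
have F0 : fs l = qc q (xs l) (ys 0) by rewrite (qc_xs_ys cN) ?addn0 //; lia.
have F1 : fs l.+1 = qc q (xs l.+1) (ys 0) by rewrite (qc_xs_ys cN) ?addn0 //; lia.
have F1' : fs l.+1 = qc q (xs l) (ys 1) by rewrite (qc_xs_ys cN) ?addn1 //; lia.
(* For [m = 0] the index l + 2 is out of reach of [qc_xs_ys], but p_0 = 1 makes both brackets
   vanish. *)
have F2 : br (ps m) (fs l.+2) = br (ps m) (qc q (xs l.+1) (ys 1)).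
  case: m mlN => [|m] mlN; first by rewrite /br !(mul1r, mulr1) !subrr.
  by rewrite (qc_xs_ys cN) ?addn1 //; lia.
have := @br_qc_rec F q n q0 (ps m) (ps m.+1) (ps m.+2) (xs l) (xs l.+1) B (ys 1).
rewrite !(br_ps_xs cN) ?(br_ps_ys0 cN) -?F0 -?F1 -?F1' -?F2; try lia.
move=> /(_ erefl erefl erefl erefl erefl) e.
have pE k : ps k.+1 = (q - 1)^-1 *: fs k by [].
move: e; rewrite !(pE l) !(pE l.+1) !(pE l.+2).
move: (ps _) (ps _) (ps _) (fs _) (fs _) (fs _) => ? ? p2 ? ? f2 e.
transitivity ((q - 1)^-1 *: br p2 f2); first by rewrite /br; ncring.
by rewrite e /br; ncring.
Qed.

Lemma br_ps0l M : br (ps 0) M = 0. Proof. by rewrite /br mul1r mulr1 subrr. Qed.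
Lemma br_ps0r M : br M (ps 0) = 0. Proof. by rewrite /br mul1r mulr1 subrr. Qed.

Lemma br_ps k l : br (ps k) (ps l) = 0.
Proof.
suff cN N : com N by apply: (cN (k + l)%N).
elim: N => [|N cN] i j ijN.
  have [-> ->] : i = 0%N /\ j = 0%N by lia.
  exact: br_ps0l.
have [ijN'|eN] := leqP (i + j) N; first exact: cN.
have -> : j = (N.+1 - i)%N by lia.
have [->|iN] : (i = N.+1 \/ i <= N)%N by lia.
  by rewrite subnn br_ps0r.
have [->|i0] := posnP i; first exact: br_ps0l.
(* For N = 1 the only nontrivial bracket is that of p_1 with itself. *)
have [N1|N1] : (N = 1 \/ 1 < N)%N by lia.
  have -> : i = 1%N by lia.
  by rewrite N1 /br subrr.
pose K m := br (ps m) (ps (N.+1 - m)%N).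
apply: (@chebyshev_zero _ q q0 qnr n K N) => //.
- exact: br_ps0l.
- move=> m mN; rewrite /K.
  have -> : (N.+1 - m.+1 = (N.-1 - m).+1)%N by lia.
  rewrite (@br_ps_rec N) //; [|lia|lia].
  by congr (_ *: br _ (ps _) - br _ (ps _)); lia.
(* Antisymmetry of the bracket supplies the boundary condition K N = - K 1. *)
- rewrite /K br_antisym; congr (- br (ps _) (ps _)); lia.
Qed.

Lemma qc_xs_ysE i j : qc q (xs i) (ys j) = fs (i + j).
Proof. by apply: (@qc_xs_ys (i + j).+1) => // k l _; apply: br_ps. Qed.

Lemma br_ps_xsE m i :
  br (ps m.+1) (xs i) = q *: (ps m * xs i.+1) - q^-1 *: (xs i.+1 * ps m).
Proof.
apply: (@br_ps_xs m.+2) => [k l _||]; first exact: br_ps.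
  by lia.
by rewrite ltnSn orbT.
Qed.

End RootVectors.

Arguments ps : simpl never.

(** * Power series *)

Definition fps (F : fieldType) : Type := nat -> F.

(* The operations are locked, as unification would otherwise unfold them. *)
HB.lock Definition fps_add (F : fieldType) (f g : fps F) : fps F :=
  fun k => f k + g k.
HB.lock Definition fps_opp (F : fieldType) (f : fps F) : fps F := fun k => - f k.
HB.lock Definition K (F : fieldType) (c : F) : fps F :=
  fun k => if k is 0%N then c else 0.
HB.lock Definition fps_mul (F : fieldType) (f g : fps F) : fps F :=
  fun k => \sum_(i < k.+1) f i * g (k - i)%N.
HB.lock Definition fps_X (F : fieldType) : fps F := fun k => (k == 1%N)%:R.

Section PowerSeriesRing.
Variable F : fieldType.
Implicit Types f g h : fps F.

HB.instance Definition _ := gen_eqMixin (fps F).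
HB.instance Definition _ := gen_choiceMixin (fps F).

Lemma fps_addE f g k : fps_add f g k = f k + g k.
Proof. by rewrite fps_add.unlock. Qed.
Lemma fps_oppE f k : fps_opp f k = - f k.
Proof. by rewrite fps_opp.unlock. Qed.
Lemma KE (c : F) k : K c k = if k is 0%N then c else 0.
Proof. by rewrite K.unlock. Qed.
Lemma fps_XE k : fps_X F k = (k == 1%N)%:R.
Proof. by rewrite fps_X.unlock. Qed.
Lemma fps_mulE f g k : fps_mul f g k = \sum_(i < k.+1) f i * g (k - i)%N.
Proof. by rewrite fps_mul.unlock. Qed.

Fact fps_addA : associative (@fps_add F).
Proof. by move=> f g h; apply/funext => k; rewrite !fps_addE addrA. Qed.
Fact fps_addC : commutative (@fps_add F).
Proof. by move=> f g; apply/funext => k; rewrite !fps_addE addrC. Qed.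
Fact fps_add0 : left_id (K 0) (@fps_add F).
Proof.
by move=> f; apply/funext => k; rewrite fps_addE KE; case: k => *; rewrite add0r.
Qed.
Fact fps_addN : left_inverse (K 0) (@fps_opp F) (@fps_add F).
Proof.
by move=> f; apply/funext => k; rewrite fps_addE fps_oppE KE addNr; case: k.
Qed.
HB.instance Definition _ :=
  GRing.isZmodule.Build (fps F) fps_addA fps_addC fps_add0 fps_addN.

(** A coefficient of a product depends only on truncations, so the ring axioms are inherited from
    polynomials. *)
Definition fps_trunc N f : {poly F} := \poly_(i < N) f i.

Fact fps_mul_trunc N f g k : (k < N)%N ->
  fps_mul f g k = (fps_trunc N f * fps_trunc N g)`_k.
Proof.
move=> kN; rewrite fps_mulE coefM; apply: eq_bigr => i _.
by rewrite !coef_poly !ifT //; [lia | have := ltn_ord i; lia].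
Qed.

Fact fps_mulC : commutative (@fps_mul F).
Proof.
by move=> f g; apply/funext => k; rewrite !(@fps_mul_trunc k.+1) // mulrC.
Qed.
Fact fps_mulA : associative (@fps_mul F).
Proof.
move=> f g h; apply/funext => k.
transitivity (fps_trunc k.+1 f * fps_trunc k.+1 g * fps_trunc k.+1 h)`_k.
  rewrite fps_mulE -mulrA coefM; apply: eq_bigr => i _.
  rewrite coef_poly ltn_ord (@fps_mul_trunc k.+1) //; lia.
rewrite fps_mulE coefM; apply: eq_bigr => i _.
by rewrite -(@fps_mul_trunc k.+1) // coef_poly ifT //; lia.
Qed.
Fact fps_mul1 : left_id (K 1) (@fps_mul F).
Proof.
move=> f; apply/funext => k; rewrite fps_mulE big_ord_recl KE mul1r subn0.
by rewrite big1 ?addr0 // => i _; rewrite KE mul0r.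
Qed.
Fact fps_mulDl : left_distributive (@fps_mul F) (@fps_add F).
Proof.
move=> f g h; apply/funext => k; rewrite fps_addE !fps_mulE -big_split /=.
by apply: eq_bigr => i _; rewrite fps_addE mulrDl.
Qed.
Fact fps_1neq0 : K 1 != K 0 :> fps F.
Proof.
by apply/eqP => /(congr1 (@^~ 0%N)) /eqP; rewrite !KE (negPf (oner_neq0 _)).
Qed.
HB.instance Definition _ :=
  GRing.Zmodule_isComNzRing.Build (fps F) fps_mulA fps_mulC fps_mul1 fps_mulDl
    fps_1neq0.

Lemma fpsD f g k : (f + g) k = f k + g k. Proof. exact: fps_addE. Qed.
Lemma fpsN f k : (- f) k = - f k. Proof. exact: fps_oppE. Qed.
Lemma fpsM f g k : (f * g) k = \sum_(i < k.+1) f i * g (k - i)%N.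
Proof. exact: fps_mulE. Qed.
Lemma fps0 k : (0 : fps F) k = 0. Proof. by rewrite [LHS]KE; case: k. Qed.
Lemma fps1 k : (1 : fps F) k = (k == 0%N)%:R. Proof. by rewrite [LHS]KE; case: k. Qed.

Definition fps_scale (c : F) f : fps F := fun k => c ^+ k * f k.

End PowerSeriesRing.

(** * Matrices over power series and their coefficients *)

Section SeriesMatrices.
Variables (F : fieldType) (n : nat).
Implicit Types (u v : nat -> 'M[F]_n.+1) (U V : 'M[fps F]_n.+1) (c : F).

Definition ser u : 'M[fps F]_n.+1 := \matrix_(i, j) (fun k => u k i j).
Definition cf k U : 'M[F]_n.+1 := \matrix_(i, j) U i j k.
Notation t := (fps_X F).
(** The substitution of ct for t. *)
Definition sub c U : 'M[fps F]_n.+1 := map_mx (fps_scale c) U.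

Lemma cfP U V : (forall k, cf k U = cf k V) -> U = V.
Proof.
move=> UV; apply/matrixP => i j; apply/funext => k.
by have /matrixP/(_ i j) := UV k; rewrite !mxE.
Qed.

Lemma cf_ser u k : cf k (ser u) = u k.
Proof. by apply/matrixP => i j; rewrite !mxE. Qed.

Lemma cfD k U V : cf k (U + V) = cf k U + cf k V.
Proof. by apply/matrixP => i j; rewrite !mxE fpsD. Qed.

Lemma cfN k U : cf k (- U) = - cf k U.
Proof. by apply/matrixP => i j; rewrite !mxE fpsN. Qed.

Lemma cf0 k : cf k 0 = 0.
Proof. by apply/matrixP => i j; rewrite !mxE fps0. Qed.

Lemma cf1 k : cf k 1 = (k == 0%N)%:R.
Proof.
apply/matrixP => i j; rewrite !mxE; case: k => [|k]; case ij: (i == j);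
by rewrite ?mulr1n ?mulr0n ?fps1 ?fps0 !mxE ?ij.
Qed.

Lemma fps_sum k (I : Type) (r : seq I) (f : I -> fps F) :
  (\sum_(i <- r) f i) k = \sum_(i <- r) f i k.
Proof.
by elim: r => [|i r IH]; [rewrite !big_nil fps0 | rewrite !big_cons fpsD IH].
Qed.

Lemma cfM k U V : cf k (U * V) = \sum_(i < k.+1) cf i U * cf (k - i) V.
Proof.
apply/matrixP => i j; rewrite summxE !mxE fps_sum.
under eq_bigr do rewrite fpsM.
rewrite exchange_big /=.
by apply: eq_bigr => l _; rewrite !mxE; apply: eq_bigr => m _; rewrite !mxE.
Qed.

Lemma cfZ k c U : cf k (K c *: U) = c *: cf k U.
Proof.
apply/matrixP => i j; rewrite !mxE fpsM.
rewrite big_ord_recl KE subn0 big1 ?addr0 // => l _.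
by rewrite KE mul0r.
Qed.

Lemma cf_t0 U : cf 0 (t *: U) = 0.
Proof. by apply/matrixP => i j; rewrite !mxE fpsM big_ord1 fps_XE mul0r. Qed.

Lemma cf_tS k U : cf k.+1 (t *: U) = cf k U.
Proof.
apply/matrixP => i j; rewrite !mxE fpsM.
rewrite big_ord_recl fps_XE mul0r add0r big_ord_recl fps_XE mul1r subn1 /=.
by rewrite big1 ?addr0 // => l _; rewrite fps_XE mul0r.
Qed.

Lemma cf_sub k c U : cf k (sub c U) = c ^+ k *: cf k U.
Proof. by apply/matrixP => i j; rewrite !mxE. Qed.

Definition cfE := (cf_ser, cfD, cfN, cf0, cf1, cfZ, cf_sub).

Lemma subM c U V : sub c (U * V) = sub c U * sub c V.
Proof.
apply: cfP => k; rewrite cf_sub !cfM scaler_sumr; apply: eq_bigr => i _.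
rewrite !cf_sub -scalerAl -scalerAr scalerA -exprD subnKC //.
by have := ltn_ord i; lia.
Qed.

Lemma subD c U V : sub c (U + V) = sub c U + sub c V.
Proof. by apply: cfP => k; rewrite !cfE scalerDr. Qed.

Lemma subN c U : sub c (- U) = - sub c U.
Proof. by apply: cfP => k; rewrite !cfE scalerN. Qed.

Lemma subZ c a U : sub c (K a *: U) = K a *: sub c U.
Proof. by apply: cfP => k; rewrite !cfE !scalerA mulrC. Qed.

Lemma subT c U : sub c (t *: U) = (K c * t) *: sub c U.
Proof.
apply: cfP => -[|k]; rewrite -scalerA !cfE ?cf_t0 ?cf_tS ?scaler0 //.
by rewrite cf_sub scalerA exprS.
Qed.

Lemma ser_comm u v : (forall k l, br (u k) (v l) = 0) -> ser u * ser v = ser v * ser u.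
Proof.
move=> uv; apply: cfP => k; rewrite !cfM [RHS](reindex_inj rev_ord_inj) /=.
apply: eq_bigr => i _; rewrite !cf_ser subSS subKn; last by have := ltn_ord i; lia.
by apply/eqP; rewrite -subr_eq0; apply/eqP; apply: uv.
Qed.

Lemma KD c d : K (c + d) = K c + K d.
Proof. by apply/funext => k; rewrite fpsD !KE; case: k => *; rewrite ?addr0. Qed.
Lemma KN c : K (- c) = - K c.
Proof. by apply/funext => k; rewrite fpsN !KE; case: k => *; rewrite ?oppr0. Qed.
Lemma KM c d : K (c * d) = K c * K d.
Proof.
apply/funext => k; rewrite fpsM big_ord_recl big1 ?addr0 => [|i _].
  by rewrite !KE subn0; case: k => *; rewrite ?mulr0.
by rewrite KE mul0r.
Qed.
Lemma K1 : K 1 = 1 :> fps F. Proof. by []. Qed.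

(** Iterating the hypothesis makes each E_i divisible by every power of t. *)
Lemma tadic_zero c (E : nat -> 'M[fps F]_n.+1) :
  (forall i, E i = (K c * t) *: E i.+1) -> forall i, E i = 0.
Proof.
move=> EE i; apply: cfP => k; rewrite cf0.
elim: k i => [|k IH] i; rewrite EE -scalerA cfZ ?cf_t0 ?cf_tS ?IH scaler0 //.
Qed.

End SeriesMatrices.

Section StrongRecursion.
Variables (T : Type) (d : T) (Phi : nat -> (nat -> T) -> T).

(** Stage m is final at the indices below m and holds the default [d] elsewhere. *)
Fixpoint srec_stage m k : T :=
  if m is m'.+1 then if k == m' then Phi m' (srec_stage m') else srec_stage m' k
  else d.

Definition srec k := srec_stage k.+1 k.

Lemma srecE k : (forall f g, (forall i, (i < k)%N -> f i = g i) -> Phi k f = Phi k g) ->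
  srec k = Phi k srec.
Proof.
move=> ext; rewrite /srec /= eqxx; apply: ext => i; elim: k => // k IH.
rewrite ltnS leq_eqVlt => /predU1P[->|ik]; first by rewrite /= eqxx.
by rewrite -IH //= ltn_eqF.
Qed.

End StrongRecursion.

Section ConstantSeries.
Variables (F : fieldType) (n : nat).
Implicit Types (M : 'M[F]_n.+1) (U : 'M[fps F]_n.+1).

Definition cst M : 'M[fps F]_n.+1 := ser (fun k => if k is 0%N then M else 0).

Lemma cf_cstr k U M : cf k (U * cst M) = cf k U * M.
Proof.
rewrite cfM big_ord_recr /= subnn cf_ser big1 ?add0r // => i _.
rewrite cf_ser; case: (k - i)%N (subn_gt0 i k) => [|m _]; last by rewrite mulr0.
by rewrite ltn_ord.
Qed.

Lemma cf_cstl k U M : cf k (cst M * U) = M * cf k U.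
Proof.
rewrite cfM big_ord_recl /= subn0 cf_ser big1 ?addr0 // => i _.
by rewrite cf_ser mul0r.
Qed.

Lemma sub_cst c M : sub c (cst M) = cst M.
Proof.
by apply: cfP => -[|k]; rewrite cf_sub !cf_ser ?scaler0 // expr0 scale1r.
Qed.

Lemma sub_ser c (u : nat -> 'M[F]_n.+1) : sub c (ser u) = ser (fun k => c ^+ k *: u k).
Proof. by apply: cfP => k; rewrite cf_sub !cf_ser. Qed.

Lemma K_cancel c U : c != 0 -> K c *: U = 0 -> U = 0.
Proof.
move=> c0 /(congr1 (cf _)) cU; apply: cfP => k; have := cU k.
by rewrite cfZ !cf0 => /eqP; rewrite scaler_eq0 (negPf c0) => /eqP.
Qed.

End ConstantSeries.

(** * The twisted square root G of the inverse of P *)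

Section SquareRootSeries.
Variables (F : numFieldType) (q : F).
Hypotheses (q0 : q != 0) (qnr : forall k, (0 < k)%N -> q ^+ k != 1).
Variables (n : nat) (p : nat -> 'M[F]_n.+1).
Hypotheses (p0 : p 0 = 1) (pC : forall k l, br (p k) (p l) = 0).

Let qi := q^-1.
Let P := ser p.

(* The solution of P(t) G(t) = P(t/q) G(t/q^2) with G(0) = 1, which satisfies
   P(t) G(t) G(t/q) = 1. *)
Definition gs : nat -> 'M[F]_n.+1 := srec 0 (fun k g =>
  if k is 0%N then 1 else
  (1 - qi ^+ (2 * k))^-1 *:
   \sum_(i < k) (qi ^+ (2 * k - i.+1) - 1) *: (p i.+1 * g (k - i.+1)%N)).

Lemma gs0 : gs 0 = 1. Proof. by []. Qed.

Lemma qi_neq1 k : (0 < k)%N -> 1 - qi ^+ k != 0.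
Proof. by move=> k0; rewrite subr_eq0 eq_sym exprVn invr_eq1 qnr. Qed.

Lemma gsE k : (0 < k)%N -> (1 - qi ^+ (2 * k)) *: gs k =
   \sum_(i < k) (qi ^+ (2 * k - i.+1) - 1) *: (p i.+1 * gs (k - i.+1)%N).
Proof.
case: k => // k _; rewrite {1}/gs srecE => [|f g fg].
  by rewrite scalerA divff ?scale1r // qi_neq1.
congr (_ *: _); apply: eq_bigr => i _; congr (_ *: (_ * _)); apply: fg; lia.
Qed.

Lemma br_gs M : (forall k, br (p k) M = 0) -> forall k, br (gs k) M = 0.
Proof.
move=> pM k; elim/ltn_ind: k => -[|k] IH.
  by rewrite gs0 /br mul1r mulr1 subrr.
have k0 : (0 < 2 * k.+1)%N by lia.
apply/eqP; rewrite -(inj_eq (scalerI (qi_neq1 k0))) scaler0 /br scalerBr.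
rewrite scalerAl scalerAr gsE // mulr_suml mulr_sumr -sumrB big1 // => i _.
rewrite -scalerAl -scalerAr -scalerBr.
have /eqP := pM i.+1; rewrite subr_eq0 => /eqP e1.
have /eqP := IH (k.+1 - i.+1)%N ltac:(lia); rewrite subr_eq0 => /eqP e2.
by rewrite -mulrA e2 !mulrA e1 subrr scaler0.
Qed.

Lemma br_gs_ps k l : br (gs k) (p l) = 0.
Proof. exact: br_gs. Qed.

Lemma br_gs_gs k l : br (gs k) (gs l) = 0.
Proof.
by apply: br_gs => m; rewrite br_antisym br_gs_ps oppr0.
Qed.

Let G := ser gs.
Let G' := sub qi G.

Lemma GG' : G * G' = G' * G.
Proof.
rewrite /G' sub_ser; apply: ser_comm => k l.
by rewrite /br -scalerAr -scalerAl -scalerBr -/(br _ _) br_gs_gs scaler0.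
Qed.

Lemma PG_comm : P * G = G * P.
Proof. by apply: ser_comm => k l; rewrite br_antisym br_gs_ps oppr0. Qed.

Lemma PG'_comm : P * G' = G' * P.
Proof.
rewrite /G' sub_ser; apply: ser_comm => k l.
by rewrite br_antisym /br -scalerAr -scalerAl -scalerBr -/(br _ _) br_gs_ps scaler0 oppr0.
Qed.

Lemma PG_shift : P * G = sub qi P * sub qi G'.
Proof.
apply: cfP => k; rewrite !cfM; case: k => [|k].
  by rewrite !big_ord1 !cf_sub expr0 !scale1r.
rewrite big_ord_recl [RHS]big_ord_recl /= !subn0 !cf_sub !cf_ser p0 !mul1r.
rewrite expr0 !scale1r !mul1r scalerA -exprD addnn -mul2n.
have H : gs k.+1 - qi ^+ (2 * k.+1) *: gs k.+1 =
   \sum_(i < k.+1) (qi ^+ (2 * k.+1 - i.+1) - 1) *: (p i.+1 * gs (k.+1 - i.+1)%N).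
  by rewrite -gsE // scalerBl scale1r.
rewrite -[gs k.+1 in LHS](subrK (qi ^+ (2 * k.+1) *: gs k.+1)) H.
rewrite addrAC addrC; congr (_ + _); rewrite -big_split /=; apply: eq_bigr => i _.
rewrite !cf_sub !cf_ser /bump !add1n /= -scalerAl -!scalerAr !scalerA.
have -> : qi ^+ i.+1 * (qi ^+ (k.+1 - i.+1) * qi ^+ (k.+1 - i.+1)) =
          qi ^+ (2 * k.+1 - i.+1).
  by rewrite -!exprD; congr (_ ^+ _); have := ltn_ord i; lia.
by rewrite scalerBl scale1r subrK.
Qed.

(** By [PG_shift] the product is invariant under replacing t by t/q; since q^k <> 1 for k > 0, only
    its constant term survives. *)
Lemma PGG' : P * (G * G') = 1.
Proof.
set Z := P * (G * G').
have ZZ : sub qi Z = Z.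
  rewrite /Z !subM -/G'.
  have e : G' * sub qi G' = sub qi G' * G'.
    by rewrite -[G']/(sub qi G) -!subM GG'.
  by rewrite e mulrA -PG_shift mulrA.
apply: cfP => -[|k].
  rewrite /Z !cfM !big_ord1 cfM big_ord1 /= cf_sub expr0 scale1r !cf_ser p0 cf1.
  by rewrite !mul1r.
have := congr1 (cf k.+1) ZZ; rewrite cf_sub => /eqP.
rewrite -subr_eq0 -[X in _ - X]scale1r -scalerBl scaler_eq0 -oppr_eq0 opprB.
by rewrite (negPf (qi_neq1 _)) //= => /eqP ->; rewrite cf1.
Qed.

Lemma GG'P : G * G' * P = 1.
Proof. by rewrite -PGG' -mulrA -PG'_comm !mulrA PG_comm. Qed.

(** The lowest nonzero coefficient of [E], of degree k say, would be killed by 1 + q^-k. This is the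
    uniqueness of the twisted square root, in linearised form. *)
Lemma G_zero_divisor E : E * G' + G * sub qi E = 0 -> E = 0.
Proof.
move=> /(congr1 (cf _)) E0; apply: cfP; elim/ltn_ind => k IH.
have := E0 k; rewrite !cf0 cfD !cfM.
rewrite big_ord_recr big1 /= => [|i _]; last by rewrite IH ?cf0 ?mul0r.
rewrite [X in _ + X]big_ord_recl [X in _ + (_ + X)]big1 /= => [|i _].
  rewrite subnn subn0 !cf_sub !cf_ser expr0 scale1r gs0 mulr1 mul1r addr0 add0r.
  rewrite -[X in X + _]scale1r -scalerDl => /eqP; rewrite scaler_eq0 => /orP[|/eqP//].
  case: k {IH} => [|k]; first by rewrite expr0 -mulr2n (pnatr_eq0 F 2).
  rewrite addrC addr_eq0 exprVn -invrN1 (inj_eq invr_inj) => /eqP e.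
  by have := exprq_neqN1 qnr (ltn0Sn k); rewrite e eqxx.
by rewrite cf_sub IH ?cf0 ?scaler0 ?mulr0 // /bump; have := ltn_ord i; lia.
Qed.


Section Current.
Variable x : nat -> 'M[F]_n.+1.
Hypothesis px : forall m i,
  br (p m.+1) (x i) = q *: (p m * x i.+1) - q^-1 *: (x i.+1 * p m).

Notation t := (fps_X F).
Notation Q := (K q).
Notation Qi := (K q^-1).

Definition cur i : 'M[fps F]_n.+1 := ser (fun k => x (i + k)).
Let c i := cst (x i).
Let X := cur.
Let Xb i := sub q (cur i).
Let X' i := sub qi (cur i).

Lemma QQi : Q * Qi = 1.
Proof. by rewrite -KM divff ?K1. Qed.

Lemma curS i : cur i = c i + t *: cur i.+1.
Proof.
apply: cfP => -[|k]; rewrite cfD ?cf_t0 ?cf_tS !cf_ser /= ?addn0 ?addr0 //.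
by rewrite add0r addnS.
Qed.

Lemma cur_subS a i : sub a (cur i) = c i + (K a * t) *: sub a (cur i.+1).
Proof. by rewrite {1}curS subD sub_cst subT. Qed.

(** The generating function of [px] over m. *)
Lemma P_cst i : P * (c i - (Q * t) *: c i.+1) = (c i - (Qi * t) *: c i.+1) * P.
Proof.
apply: cfP => k; rewrite !(mulrBr, mulrBl) -scalerAr -scalerAl -!scalerA.
rewrite !(cfD, cfN, cfZ) cf_cstr cf_cstl !cf_ser.
case: k => [|k]; first by rewrite !cf_t0 !scaler0 !subr0 p0 mulr1 mul1r.
rewrite !cf_tS cf_cstr cf_cstl !cf_ser.
have := px k i; rewrite /br => /eqP; rewrite subr_eq => /eqP ->.
by ncring.
Qed.

(** Half of [P_cst]: applying the relation at t and then at t/q moves a constant past G G', which is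
    the inverse of P, and [G_zero_divisor] allows the two steps to be separated. *)
Lemma G_cst i : G * (c i - t *: c i.+1) = (c i - (Q * t) *: c i.+1) * G.
Proof.
apply/subr0_eq; apply: G_zero_divisor.
set a := c i - _; set b := c i - _.
have sa : sub qi a = c i - (Qi * t) *: c i.+1.
  by rewrite /a subD subN subT !sub_cst.
have sb : sub qi b = a.
  by rewrite /b subD subN -scalerA subZ subT !sub_cst scalerA mulrA QQi mul1r.
rewrite subD subN !subM -/G' sb.
have PE : P * b = sub qi a * P by rewrite sa; apply: P_cst.
(* The middle terms G a G' cancel because [b] at t/q is [a]; what remains is [P_cst] for the inverse
   of P. *)
transitivity (G * G' * sub qi a - b * (G * G')); first by ncring.
rewrite -[_ * sub qi a]mulr1 -PGG' -[b * _]mul1r -GG'P.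
by apply/eqP; rewrite subr_eq0 !mulrA -(mulrA _ _ P) -PE !mulrA.
Qed.

(* In each of the next lemmas the difference E_i of the two sides satisfies
   E_i = c t E_{i+1} for a constant c, hence vanishes. *)
Lemma G_cst_cur i : G * c i = (Q *: c i - (Q - 1) *: X i) * G.
Proof.
apply/subr0_eq; move: i; apply: (@tadic_zero F n 1) => i.
rewrite K1 mul1r {1}/X curS -/(X _); have := G_cst i.
move: (c i) (c i.+1) (X i.+1) => c0 c1 Y e.
apply/subr0_eq; transitivity (G * (c0 - t *: c1) - (c0 - (Q * t) *: c1) * G).
  by ncring.
by rewrite e subrr.
Qed.

Lemma cst_G_cur i : c i * G = G * (Qi *: c i + (1 - Qi) *: Xb i).
Proof.
apply/subr0_eq; move: i; apply: (@tadic_zero F n q) => i.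
rewrite /Xb cur_subS -/(Xb _); have := G_cst i.
move: (c i) (c i.+1) (Xb i.+1) => c0 c1 Y e.
apply/subr0_eq; transitivity ((c0 - (Q * t) *: c1) * G - G * (c0 - t *: c1)).
  by ncring: QQi.
by rewrite e subrr.
Qed.

Lemma cur_G i : X i * G = G * Xb i.
Proof.
apply/subr0_eq; apply: (@K_cancel F n (q - 1)).
  by rewrite subr_eq0 -[q]expr1 qnr.
rewrite KD KN K1; have := G_cst_cur i; have := cst_G_cur i.
move: (c i) (X i) (Xb i) => c0 Y Yb e1 e2.
transitivity (Q *: (c0 * G - G * (Qi *: c0 + (1 - Qi) *: Yb))
  - ((Q *: c0 - (Q - 1) *: Y) * G - G * c0)); first by ncring: QQi.
by rewrite e1 e2 !subrr scaler0 subr0.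
Qed.

Lemma P_cur i : P * X' i = Xb i * P.
Proof.
(* The one-step form: c_j is what X_j(qt) loses when its tail q t X_(j+1)(qt) is removed, so the
   claim follows by telescoping. *)
have c0E j : P * (X' j - (Q * t) *: X' j.+1) = c j * P.
  apply/subr0_eq; move: j; apply: (@tadic_zero F n qi) => j.
  rewrite {1}/X' cur_subS -/(X' _); have := P_cst j.
  rewrite (_ : X' j.+1 = c j.+1 + (Qi * t) *: X' j.+2); last exact: cur_subS.
  move: (c j) (c j.+1) (X' j.+2) => c0 c1 Y e.
  apply/subr0_eq.
  transitivity (P * (c0 - (Q * t) *: c1) - (c0 - (Qi * t) *: c1) * P).
    by ncring: QQi.
  by rewrite e subrr.
apply/subr0_eq; move: i; apply: (@tadic_zero F n q) => i.
rewrite /Xb cur_subS -/(Xb _); have := c0E i.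
move: (c i) (X' i) (X' i.+1) (Xb i.+1) => c0 Y0 Y1 Yb e.
apply/subr0_eq; transitivity (P * (Y0 - (Q * t) *: Y1) - c0 * P).
  by ncring.
by rewrite e subrr.
Qed.

Lemma P_cst_cur i :
  P * c i = (Qi ^+ 2 *: c i + (1 - Qi ^+ 2) *: Xb i) * P.
Proof.
apply/subr0_eq; move: i; apply: (@tadic_zero F n q) => i.
rewrite /Xb cur_subS -/(Xb _); have := P_cst i.
move: (c i) (c i.+1) (Xb i.+1) => c0 c1 Y e.
apply/subr0_eq.
transitivity (P * (c0 - (Q * t) *: c1) - (c0 - (Qi * t) *: c1) * P).
  by ncring: QQi.
by rewrite e subrr.
Qed.

End Current.

End SquareRootSeries.

(** * Alternating elements *)

Section Transposition.
Variables (F : numFieldType) (q : F).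
Hypotheses (q0 : q != 0) (qnr : forall k, (0 < k)%N -> q ^+ k != 1).
Variables (n : nat) (A B : 'M[F]_n.+1).

Lemma trmx_mulr (S : comNzRingType) (M N : 'M[S]_n.+1) : (M * N)^T = N^T * M^T.
Proof. exact: trmx_mul. Qed.

Lemma trmx_ser (u : nat -> 'M[F]_n.+1) : (ser u)^T = ser (fun k => (u k)^T).
Proof.
by apply/matrixP => i j; rewrite !mxE; apply/funext => k; rewrite !mxE.
Qed.

Lemma cf_tr k (U : 'M[fps F]_n.+1) : cf k U^T = (cf k U)^T.
Proof. by apply/matrixP => i j; rewrite !mxE. Qed.

(** Passing to the pair (B^T, A^T) transposes AB - q BA, while transposition reverses the outer
    bracket; this sign is what exchanges [xs] and [ys]. *)
Lemma dz_tr M : dz q B^T A^T M^T = - (dz q A B M)^T.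
Proof.
have e : qc q B^T A^T = (qc q A B)^T.
  by rewrite /qc [in RHS]linearB [in RHS]linearZ /= !trmx_mulr.
rewrite /dz e /br [in RHS]linearZ [in RHS]linearB /= !trmx_mulr.
by rewrite -scalerN opprB.
Qed.

Lemma xs_tr k : xs q B^T A^T k = (ys q A B k)^T.
Proof.
elim: k => // k; rewrite /xs /ys !iterS => ->.
by rewrite dz_tr linearN.
Qed.

Lemma ys_tr k : ys q B^T A^T k = (xs q A B k)^T.
Proof.
elim: k => // k; rewrite /xs /ys !iterS => ->.
by rewrite dz_tr opprK.
Qed.

Hypothesis serreA : xs q A B 1 * A = q *: (A * xs q A B 1).
Hypothesis serreB : B * ys q A B 1 = q *: (ys q A B 1 * B).

Lemma serreA_tr : xs q B^T A^T 1 * B^T = q *: (B^T * xs q B^T A^T 1).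
Proof. by rewrite xs_tr -!trmx_mulr serreB linearZ. Qed.

Lemma serreB_tr : A^T * ys q B^T A^T 1 = q *: (ys q B^T A^T 1 * A^T).
Proof. by rewrite ys_tr -!trmx_mulr serreA linearZ. Qed.

Lemma ps_tr k : ps q B^T A^T k = (ps q A B k)^T.
Proof.
case: k => [|k]; rewrite /ps; first by rewrite trmx1.
rewrite linearZ /=; congr (_ *: _).
(* f_k has two expressions, from A and y_k and from x_k and B; transposition exchanges them. *)
rewrite -[in RHS](addn0 k) -(qc_xs_ysE q0 qnr serreA serreB).
by rewrite /fs /qc ys_tr [in RHS]linearB [in RHS]linearZ /= !trmx_mulr.
Qed.

(** Transposition reverses the products in the recursion of [gs], whose factors commute. *)
Lemma gs_tr k : gs q (ps q B^T A^T) k = (gs q (ps q A B) k)^T.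
Proof.
elim/ltn_ind: k => -[|k] IH; first by rewrite !gs0 trmx1.
have k0 : (0 < 2 * k.+1)%N by lia.
apply: (scalerI (qi_neq1 qnr k0)).
rewrite -linearZ /= !gsE // linear_sum; apply: eq_bigr => i _.
rewrite linearZ /= trmx_mulr IH ?ps_tr; last by lia.
rewrite -!trmx_mulr; congr (_ *: _^T).
apply/eqP; rewrite -subr_eq0; apply/eqP.
by apply: br_gs_ps => // *; apply: br_ps.
Qed.

End Transposition.

Section AlternatingSeries.
Variables (F : numFieldType) (q : F).
Hypotheses (q0 : q != 0) (qnr : forall k, (0 < k)%N -> q ^+ k != 1).
Variable n : nat.
Implicit Types A B : 'M[F]_n.+1.

Notation t := (fps_X F).
Notation Q := (K q).
Notation Qi := (K q^-1).

(* Ws, Vs, Gs, Hs are the generating functions of W_{-k}, W_{k+1}, G_k, G~_k. *)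
Definition Ps A B := ser (ps q A B).
Definition Gs A B := ser (gs q (ps q A B)).
Definition Xs A B := cur (xs q A B) 0.
Definition Ys A B := cur (ys q A B) 0.
Definition Ws A B := Xs A B * Gs A B.
Definition Vs A B := Gs A B * Ys A B.
Definition Hs A B := (Ps A B + t *: (Xs A B * sub q (Ys A B))) * Gs A B.

Variables A B : 'M[F]_n.+1.
Hypothesis serreA : xs q A B 1 * A = q *: (A * xs q A B 1).
Hypothesis serreB : B * ys q A B 1 = q *: (ys q A B 1 * B).

Let p0 : ps q A B 0 = 1. Proof. by []. Qed.
Let pC := br_ps q0 qnr serreA serreB.
Let px := br_ps_xsE q0 qnr serreA serreB.
Let QQ := @QQi F q q0.
Let q1 : q - 1 != 0 := q_sub1_neq0 qnr.

Notation P := (Ps A B).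
Notation G := (Gs A B).
Notation G' := (sub q^-1 (Gs A B)).
Notation X := (Xs A B).
Notation Y := (Ys A B).
Notation Xb := (sub q (Xs A B)).
Notation Yb := (sub q (Ys A B)).
Notation X' := (sub q^-1 (Xs A B)).
Notation cA := (cst A).
Notation cB := (cst B).

Lemma Gs_A : G * cA = (Q *: cA - (Q - 1) *: X) * G.
Proof. exact: (G_cst_cur q0 qnr p0 pC px 0). Qed.

Lemma A_Gs : cA * G = G * (Qi *: cA + (1 - Qi) *: Xb).
Proof. exact: (cst_G_cur q0 qnr p0 pC px 0). Qed.

Lemma Xs_Gs : X * G = G * Xb.
Proof. exact: (cur_G q0 qnr p0 pC px 0). Qed.

Lemma Ps_Xs : P * X' = Xb * P.
Proof. exact: (P_cur q0 p0 px 0). Qed.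

Lemma Ps_A : P * cA = (Qi ^+ 2 *: cA + (1 - Qi ^+ 2) *: Xb) * P.
Proof. exact: (P_cst_cur q0 p0 px 0). Qed.

Lemma Ps_GG' : P * (G * G') = 1. Proof. exact: PGG'. Qed.
Lemma GG'_Ps : G * G' * P = 1. Proof. exact: GG'P. Qed.
Lemma G'_Gs : G' * G = G * G'. Proof. by rewrite [RHS]GG'. Qed.

End AlternatingSeries.

(** * Relations between the generating functions *)

Section AlternatingRelations.
Variables (F : numFieldType) (q : F).
Hypotheses (q0 : q != 0) (qnr : forall k, (0 < k)%N -> q ^+ k != 1).
Variable n : nat.
Implicit Types A B : 'M[F]_n.+1.

Notation t := (fps_X F).
Notation Q := (K q).
Notation Qi := (K q^-1).

Notation Ps := (@Ps F q n).
Notation Gs := (@Gs F q n).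
Notation Xs := (@Xs F q n).
Notation Ys := (@Ys F q n).
Notation Hs := (@Hs F q n).
Notation Ws := (@Ws F q n).
Notation Vs := (@Vs F q n).
Variables A B : 'M[F]_n.+1.
Hypothesis serreA : xs q A B 1 * A = q *: (A * xs q A B 1).
Hypothesis serreB : B * ys q A B 1 = q *: (ys q A B 1 * B).

Let p0 : ps q A B 0 = 1. Proof. by []. Qed.
Let pC := br_ps q0 qnr serreA serreB.
Let px := br_ps_xsE q0 qnr serreA serreB.
Let QQ := @QQi F q q0.
Let q1 : q - 1 != 0 := q_sub1_neq0 qnr.

Notation P := (Ps A B).
Notation G := (Gs A B).
Notation G' := (sub q^-1 (Gs A B)).
Notation X := (Xs A B).
Notation Y := (Ys A B).
Notation Xb := (sub q (Xs A B)).
Notation Yb := (sub q (Ys A B)).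
Notation X' := (sub q^-1 (Xs A B)).
Notation cA := (cst A).
Notation cB := (cst B).

Lemma Ps_AY : t *: (cA * Y - Q *: (Y * cA)) = (Q - 1) *: (P - 1).
Proof.
rewrite -[X in Q - X]K1 -KN -KD; apply: cfP => -[|k]; rewrite cfZ cfD cfN cf1.
  by rewrite cf_t0 cf_ser p0 subrr scaler0.
rewrite cf_tS cfD cfN cfZ cf_cstl cf_cstr !cf_ser add0n subr0.
by rewrite -fsE.
Qed.

Lemma Ps_XB : t *: (X * cB - Q *: (cB * X)) = (Q - 1) *: (P - 1).
Proof.
rewrite -[X in Q - X]K1 -KN -KD; apply: cfP => -[|k]; rewrite cfZ cfD cfN cf1.
  by rewrite cf_t0 cf_ser p0 subrr scaler0.
rewrite cf_tS cfD cfN cfZ cf_cstl cf_cstr !cf_ser add0n subr0.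
by have := qc_xs_ysE q0 qnr serreA serreB k 0; rewrite addn0 -fsE.
Qed.

(** In degree k + 1 every q-commutator of x_i and y_j with i + j = k equals f_k; the weights q^-i
    add up to a geometric sum. *)
Lemma Ps_XY : (Qi * t) *: (X' * Y - Q *: (Y * X')) = P - sub q^-1 P.
Proof.
apply: cfP => -[|k]; rewrite -scalerA cfZ cfD cfN cf_sub.
  by rewrite cf_t0 cf_ser p0 expr0 scale1r subrr scaler0.
rewrite cf_tS cfD cfN cfZ !cfM [X in _ - _ *: X](reindex_inj rev_ord_inj) /=.
rewrite scaler_sumr -sumrB; under eq_bigr => i _.
  rewrite subSS subKn; last by have := ltn_ord i; lia.
  rewrite !cf_sub !cf_ser !add0n -scalerAl -scalerAr scalerA [q * _]mulrC -scalerA.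
  rewrite -scalerBr -/(qc q _ _) (qc_xs_ysE q0 qnr serreA serreB).
  rewrite subnKC; last by have := ltn_ord i; lia.
  over.
rewrite -scaler_suml !cf_ser -[X in X - _]scale1r -scalerBl /ps !scalerA.
congr (_ *: _); have := subrX1 q^-1 k.+1.
set s := \sum_(i < k.+1) _ => e.
have -> : 1 - q^-1 ^+ k.+1 = - ((q^-1 - 1) * s) by rewrite -e opprB.
by field; rewrite q0 q1.
Qed.

(** Conjugating x_1 A = q A x_1 by [G] gives a quadratic identity [E = 0] between X and its shift
    X_1. The derivation [D] sends A to x_1 and X to X_1, and with [E = 0] it yields (q + 1) H = q t
    D(H) for the left side [H], so [H] vanishes degree by degree. *)
Lemma quadratic_Xs : cA * X - Q *: (X * cA) + (Q - 1) *: (X * X) = 0.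
Proof.
set H := _ + _.
pose X1 := cur (xs q A B) 1; pose x1 := cst (xs q A B 1).
have XE : X = cA + t *: X1 by rewrite /Xs curS.
have G1 : G * x1 = (Q *: x1 - (Q - 1) *: X1) * G.
  exact: (G_cst_cur q0 qnr p0 pC px 1).
have GA := Gs_A q0 qnr serreA serreB.
have S1 : x1 * cA - Q *: (cA * x1) = 0.
  apply: cfP => k; rewrite cfD cfN cfZ !cf_cstr !cf_ser cf0.
  by case: k => [|k]; rewrite ?mul0r ?scaler0 ?subrr // serreA subrr.
pose E := (Q *: x1 - (Q - 1) *: X1) * (Q *: cA - (Q - 1) *: X)
   - Q *: ((Q *: cA - (Q - 1) *: X) * (Q *: x1 - (Q - 1) *: X1)).
(* [G] moves through [E] and turns it into the Serre relation; it is then cancelled by means of P G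
   G' = 1. *)
have E0 : E = 0.
  rewrite -[E]mulr1 -(Ps_GG' q0 qnr serreA serreB) mulrA.
  have -> : E * (P * G * G') = E * G * P * G'.
    by rewrite (PG_comm q0 qnr pC) !mulrA.
  have -> : E * G = 0; last by rewrite !mul0r.
  transitivity (G * (x1 * cA - Q *: (cA * x1))); last by rewrite S1 mulr0.
  rewrite /E mulrBl -scalerAl -!mulrA -GA -G1 !mulrA -GA -G1.
  by ncring.
pose Z := cst (qc q A B).
pose D U := K (kap q) *: (Z * U - U * Z).
have DM U V : D (U * V) = D U * V + U * D V by rewrite /D; ncring.
have DZ c U : D (c *: U) = c *: D U by rewrite /D; ncring.
have DD U V : D (U + V) = D U + D V by rewrite /D; ncring.
have DN U : D (- U) = - D U by rewrite /D; ncring.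
have DA : D cA = x1.
  apply: cfP => k; rewrite cfZ cfD cfN cf_cstl cf_cstr !cf_ser.
  by case: k => [|k] //; rewrite mul0r mulr0 subrr scaler0.
have DX : D X = X1.
  apply: cfP => k; rewrite cfZ cfD cfN cf_cstl cf_cstr !cf_ser.
  by rewrite add0n add1n.
have HD : (Q + 1) *: H = (Q * t) *: D H.
  have DHE : D H = x1 * X + cA * X1 - Q *: (X1 * cA + X * x1)
      + (Q - 1) *: (X1 * X + X * X1).
    by rewrite /H !(DD, DN, DZ, DM) DA DX.
  have e : (Q - 1) *: ((Q + 1) *: H - (Q * t) *: D H)
      = t *: E - (Q ^+ 2 * t) *: (x1 * cA - Q *: (cA * x1)).
    rewrite DHE /H /E XE.
    by ncring.
  apply/subr0_eq; apply: (K_cancel q1); rewrite KD KN K1 e E0 S1.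
  by rewrite !scaler0 subrr.
have qp : q + 1 != 0 := q_add1_neq0 qnr.
apply: cfP => k; rewrite cf0.
have {}HD m : (q + 1) *: cf m H = cf m ((Q * t) *: D H).
  by rewrite -HD -[X in Q + X]K1 -KD cfZ.
elim: k => [|k IH]; apply: (scalerI qp); rewrite scaler0 HD -scalerA cfZ.
  by rewrite cf_t0 scaler0.
by rewrite cf_tS cfZ cfD cfN cf_cstl cf_cstr IH mulr0 mul0r subrr !scaler0.
Qed.
Lemma trmx_sub c (U : 'M[fps F]_n.+1) : (sub c U)^T = sub c U^T.
Proof. by rewrite /sub map_trmx. Qed.

Lemma trmx_cst (M : 'M[F]_n.+1) : (cst M)^T = cst M^T.
Proof. by rewrite trmx_ser; congr ser; apply/funext => -[|k] //; rewrite trmx0. Qed.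

Lemma Gs_tr : Gs B^T A^T = G^T.
Proof. by rewrite trmx_ser; congr ser; apply/funext => k; rewrite gs_tr. Qed.

Lemma Ps_tr : Ps B^T A^T = P^T.
Proof. by rewrite trmx_ser; congr ser; apply/funext => k; rewrite ps_tr. Qed.

Lemma Xs_tr : Xs B^T A^T = Y^T.
Proof. by rewrite trmx_ser; congr ser; apply/funext => k; rewrite xs_tr. Qed.

Lemma Ys_tr : Ys B^T A^T = X^T.
Proof. by rewrite trmx_ser; congr ser; apply/funext => k; rewrite ys_tr. Qed.

(** The transpose of [A_Gs] for the pair (B^T, A^T), which again satisfies the Serre relations. *)
Lemma Gs_B : G * cB = (Qi *: cB + (1 - Qi) *: Yb) * G.
Proof.
apply: trmx_inj; rewrite !trmx_mulr [in RHS]linearD [in RHS]linearZ.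
rewrite [X in _ = _ * (_ + X)]linearZ /= trmx_sub trmx_cst -Gs_tr -Xs_tr.
exact: A_Gs (serreA_tr serreB) (serreB_tr serreA).
Qed.

Lemma B_Gs : cB * G = G * (Q *: cB - (Q - 1) *: Y).
Proof.
apply: trmx_inj; rewrite !trmx_mulr [in RHS]linearB [in RHS]linearZ.
rewrite [X in _ = (_ - X) * _]linearZ /= trmx_cst -Gs_tr -Xs_tr.
exact: Gs_A (serreA_tr serreB) (serreB_tr serreA).
Qed.

Lemma Ws_def : (Q - 1) *: Ws A B = Q *: (cA * G) - G * cA.
Proof.
rewrite (Gs_A q0 qnr serreA serreB) /Ws; move: cA G X => a g x; ncring.
Qed.

Lemma Vs_def : (Q - 1) *: Vs A B = Q *: (G * cB) - cB * G.
Proof. by rewrite B_Gs /Vs; move: cB G Y => a g x; ncring. Qed.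

Lemma Z_Gs : G * (cA * cB - Q *: (cB * cA)) = (cA * cB - Q *: (cB * cA)) * G.
Proof.
have -> : cA * cB - Q *: (cB * cA) = cst (qc q A B).
  apply: cfP => k; rewrite cfD cfN cfZ !cf_cstr !cf_ser.
  by case: k => [|k]; rewrite ?mul0r ?scaler0 ?subrr.
apply: ser_comm => k [|l]; last by rewrite /br mulr0 mul0r subrr.
have -> : qc q A B = (q - 1) *: ps q A B 1 by rewrite -fsE.
rewrite /br -scalerAr -scalerAl -scalerBr -/(br _ _).
by rewrite (br_gs_ps q0 qnr) // scaler0.
Qed.

(** Up to the factor q - 1 the difference is the bracket of G with AB - q BA, a multiple of p_1. *)
Lemma br_A_Vs : br cA (Vs A B) = br (Ws A B) cB.
Proof.
apply/subr0_eq; apply: (K_cancel q1); rewrite KD KN K1.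
have e : (Q - 1) *: (br cA (Vs A B) - br (Ws A B) cB) =
    br cA ((Q - 1) *: Vs A B) - br ((Q - 1) *: Ws A B) cB.
  by rewrite /br; ncring.
rewrite e Ws_def Vs_def.
transitivity (G * (cA * cB - Q *: (cB * cA)) - (cA * cB - Q *: (cB * cA)) * G).
  by rewrite /br; ncring.
by rewrite Z_Gs subrr.
Qed.

Lemma Hs_Ws : (1 - Qi) *: (Hs A B - G) = t *: br (Ws A B) cB.
Proof.
apply/subr0_eq.
transitivity (Qi *: ((Q - 1) *: (P - 1) - t *: (X * cB - Q *: (cB * X))) * G
   - t *: (X * (G * cB - (Qi *: cB + (1 - Qi) *: Yb) * G))).
  rewrite /Hs /Ws /br.
  by move: (Ps A B) (Gs A B) (Xs A B) (Yb) => p g x yb; ncring: QQ.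
by rewrite Gs_B Ps_XB !subrr !(mulr0, mul0r, scaler0) subrr.
Qed.

Lemma Hs_Vs : (1 - Qi) *: (Hs A B - G) = t *: br cA (Vs A B).
Proof. by rewrite Hs_Ws br_A_Vs. Qed.

(** The factorisation of [Hs] in reverse order. Transposition turns one form into the other, whence
    [Hs_tr]. *)
Lemma Hs_alt : Hs A B = G * (P + t *: (Xb * Y)).
Proof.
apply/subr0_eq; apply: (K_cancel (qi_neq1 qnr (ltn0Sn 0))).
rewrite KD KN K1 expr1.
transitivity ((1 - Qi) *: (Hs A B - G) - t *: br cA (Vs A B)
   + t *: ((cA * G - G * (Qi *: cA + (1 - Qi) *: Xb)) * Y)
   + Qi *: (G * (t *: (cA * Y - Q *: (Y * cA)) - (Q - 1) *: (P - 1)))).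
  rewrite /Vs /br.
  by move: (Hs A B) (Ps A B) (Gs A B) (Ys A B) (Xb) => h p g x yb; ncring: QQ.
rewrite Hs_Vs Ps_AY (A_Gs q0 qnr serreA serreB).
by rewrite !subrr mul0r mulr0 !scaler0 !addr0.
Qed.

(** The mirror image of [Ws_def], with G~ in place of G; it lets the transposed family satisfy the
    recursion. *)
Lemma Hs_A : Q *: (Hs A B * cA) - cA * Hs A B = (Q - 1) *: Ws A B.
Proof.
have quad : cA * Xb - Q *: (Xb * cA) + (Q - 1) *: (Xb * Xb) = 0.
  have KQ : Q - 1 = K (q - 1) by rewrite KD KN K1.
  have := congr1 (sub q) quadratic_Xs; rewrite KQ.
  have s0 : sub q (0 : 'M[fps F]_n.+1) = 0.
    by apply: cfP => k; rewrite cf_sub cf0 scaler0.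
  by rewrite s0 !(subD, subN, subZ, subM) sub_cst.
rewrite Hs_alt /Ws (Xs_Gs q0 qnr serreA serreB).
apply/subr0_eq.
transitivity (- (cA * G - G * (Qi *: cA + (1 - Qi) *: Xb)) * (P + t *: (Xb * Y))
  + G * (Q *: (P * cA - (Qi ^+ 2 *: cA + (1 - Qi ^+ 2) *: Xb) * P)
     - Xb * (t *: (cA * Y - Q *: (Y * cA)) - (Q - 1) *: (P - 1))
     - (Qi * t) *: ((cA * Xb - Q *: (Xb * cA) + (Q - 1) *: (Xb * Xb)) * Y))).
  by move: (Ps A B) (Gs A B) (Ys A B) (Xb) => p g x yb; ncring: QQ.
rewrite quad Ps_AY (A_Gs q0 qnr serreA serreB) (Ps_A q0 qnr serreA serreB).
by rewrite !subrr oppr0 !(mul0r, mulr0, scaler0, subr0, addr0).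
Qed.

Lemma br_A_Ws : br cA (Ws A B) = 0.
Proof.
transitivity ((cA * X - Q *: (X * cA) + (Q - 1) *: (X * X)) * G
  - X * (G * cA - (Q *: cA - (Q - 1) *: X) * G)).
  by rewrite /br /Ws; ncring.
by rewrite quadratic_Xs (Gs_A q0 qnr serreA serreB) subrr mul0r mulr0 subr0.
Qed.

(** In [Hs_alt] the product G' G cancels P, and moving it past X(qt) produces X(t/q). *)
Lemma qdet_GH : G' * Hs A B = 1 + t *: (sub q^-1 (Ws A B) * Vs A B).
Proof.
have XN : X' * (G * G') = G * G' * Xb.
  rewrite -[LHS]mul1r -(GG'_Ps q0 qnr serreA serreB).
  rewrite -!mulrA (mulrA P) (Ps_Xs q0 qnr serreA serreB) -!mulrA.
  by rewrite (Ps_GG' q0 qnr serreA serreB) mulr1.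
rewrite Hs_alt /Ws /Vs subM mulrA (G'_Gs q0 qnr serreA serreB).
rewrite mulrDr (GG'_Ps q0 qnr serreA serreB) -scalerAr.
rewrite -(mulrA X') (mulrA G' G) (G'_Gs q0 qnr serreA serreB).
by rewrite (mulrA X') XN mulrA.
Qed.

(** [Ps_XY] replaces P(t/q) + (t/q) X(t/q) Y by P + t Y X(t/q), and G P G' = 1. *)
Lemma qdet_HG : G * sub q^-1 (Hs A B) = 1 + t *: (Vs A B * sub q^-1 (Ws A B)).
Proof.
have -> : sub q^-1 (Hs A B) = (sub q^-1 P + (Qi * t) *: (X' * Y)) * G'.
  rewrite /Hs subM subD subT subM; congr ((_ + _ *: (_ * _)) * _).
  apply: cfP => k; rewrite !cf_sub scalerA -exprMn mulVf // expr1n.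
  by rewrite scale1r.
rewrite /Ws /Vs subM; apply/subr0_eq.
transitivity (G * P * G' - 1
   + G * ((Qi * t) *: (X' * Y - Q *: (Y * X')) - (P - sub q^-1 P)) * G').
  by move: (X') (sub q^-1 P) => x' p'; ncring: QQ.
rewrite Ps_XY subrr mulr0 mul0r addr0 -(PG_comm q0 qnr pC) -mulrA.
by rewrite (Ps_GG' q0 qnr serreA serreB) subrr.
Qed.

End AlternatingRelations.

(** * Identification with the recursively defined alternating elements *)

Section AlternatingElements.
Variables (R : realType) (q : R).
Hypotheses (q0 : q != 0) (qnr : forall k, (0 < k)%N -> q ^+ k != 1).
Variable n : nat.

Let q1 : q - 1 != 0 := q_sub1_neq0 qnr.

Lemma qi_add1_neq0 m : (0 < m)%N -> 1 + q ^- m != 0.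
Proof.
move=> m0; rewrite addrC addr_eq0 -invrN1 (inj_eq invr_inj).
exact: exprq_neqN1.
Qed.

(** The recursion for G_n is the q-determinant relation solved for g_n: its extreme terms are h_n
    and q^-n g_n, and h_n differs from g_n by a known commutator, which explains the factor 1 +
    q^-n. *)
Lemma altE (A B : 'M[R]_n.+1) (g h w v : nat -> 'M[R]_n.+1) :
  g 0%N = 1 -> h 0%N = 1 -> w 0%N = A -> v 0%N = B ->
  (forall m, \sum_(i < m.+2) q ^- i *: (g i * h (m.+1 - i)%N) =
             \sum_(i < m.+1) q ^- i *: (w i * v (m - i)%N)) ->
  (forall m, (1 - q^-1) *: (h m.+1 - g m.+1) = br A (v m)) ->
  (forall m, (q - 1) *: w m = q *: (A * g m) - g m * A) ->
  (forall m, (q - 1) *: v m = q *: (g m * B) - B * g m) ->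
  forall k, [/\ altW q A B (- k%:Z) = w k, altW q A B k.+1%:Z = v k,
                altG q A B k = g k & altH q A B k = h k].
Proof.
move=> g0 h0 w0 v0 det hg wE vE; elim/ltn_ind => -[|m] IH.
  by rewrite oppr0 altW0 altW1 altG0 altH0 g0 h0 w0 v0.
have WN k : (k <= m)%N -> altW q A B (- k%:Z) = w k by move=> km; case: (IH k).
have WP k : (k <= m)%N -> altW q A B k.+1%:Z = v k by move=> km; case: (IH k).
have W0 : altW q A B 0 = A by [].
have e1 : 1 - q^-1 != 0 by have := qi_neq1 qnr (ltn0Sn 0); rewrite expr1.
have em := qi_add1_neq0 (ltn0Sn m).
have hE : h m.+1 = g m.+1 + (1 - q^-1)^-1 *: br A (v m).
  by rewrite -hg scalerA mulVf // scale1r addrC subrK.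
have GE : altG q A B m.+1 = g m.+1.
  rewrite altGE // WP // W0; apply: (scalerI em).
  rewrite scalerDr !scalerA divff // scale1r invfM mulrA divff // mul1r.
  have -> : \sum_(0 <= k < m.+1) q ^- k *:
      (altW q A B (- k%:Z) * altW q A B (m.+1%:Z - k%:Z)) =
      \sum_(i < m.+2) q ^- i *: (g i * h (m.+1 - i)%N).
    rewrite det big_mkord; apply: eq_bigr => i _; have := ltn_ord i => im.
    have -> : m.+1%:Z - (i : nat)%:Z = (m - i).+1%:Z by lia.
    by rewrite WN ?WP //; lia.
  rewrite big_ord_recl big_ord_recr /= subnn h0 g0 subn0 mul1r mulr1 invr1 scale1r.
  have -> : \sum_(1 <= k < m.+1) q ^- k *: (altG q A B k * altH q A B (m.+1 - k)%N)
    = \sum_(i < m) q ^- (bump 0 i) *: (g (bump 0 i) * h (m.+1 - bump 0 i)%N).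
    rewrite -(big_mkord predT (fun i => q ^- (bump 0 i) *:
      (g (bump 0 i) * h (m.+1 - bump 0 i)%N))) big_add1.
    apply: eq_big_nat => i /andP[_ im]; rewrite /bump add1n.
    have [|_ _ -> _] := IH i.+1; first by lia.
    by have [|_ _ _ ->] := IH (m.+1 - i.+1)%N; first by lia.
  rewrite /bump add1n.
  move: (\sum_(i < m) _) => s; rewrite hE /comm_mx2 /br scalerDl scale1r.
  move: (v m) (g m.+1) => V G; ncring.
have HE : altH q A B m.+1 = h m.+1.
  by rewrite altHE // GE W0 WP // hE.
split => //.
- rewrite altWNE // GE W0 /qcomm_mx2 -wE scalerA mulVf // scale1r //.
- by rewrite altWSE // GE altW1 /qcomm_mx2 -vE scalerA mulVf // scale1r.
Qed.

End AlternatingElements.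

Section SymmetricGenerators.
Variables (R : realType) (q : R).
Hypotheses (q0 : q != 0) (qnr : forall k, (0 < k)%N -> q ^+ k != 1).
Variable n : nat.
Let q1 : q - 1 != 0 := q_sub1_neq0 qnr.
Notation t := (fps_X R).
Notation Q := (K q).
Notation Qi := (K q^-1).

Section Coefficients.
Variables A B : 'M[R]_n.+1.
Hypothesis serreA : xs q A B 1 * A = q *: (A * xs q A B 1).
Hypothesis serreB : B * ys q A B 1 = q *: (ys q A B 1 * B).

Let g k := gs q (ps q A B) k.
Let w k := cf k (Ws q A B).
Let v k := cf k (Vs q A B).
Let h k := cf k (Hs q A B).

Lemma Hs_tr : Hs q B^T A^T = (Hs q A B)^T.
Proof.
rewrite (Hs_alt q0 qnr serreA serreB) !trmx_mulr /Hs.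
rewrite (Gs_tr q0 qnr serreA serreB) (Ps_tr q0 qnr serreA serreB) Xs_tr Ys_tr.
by rewrite -trmx_sub [in RHS]linearD [in RHS]linearZ /= !trmx_mulr.
Qed.

Lemma Ws_tr : Ws q B^T A^T = (Vs q A B)^T.
Proof. by rewrite /Ws /Vs trmx_mulr (Gs_tr q0 qnr serreA serreB) Xs_tr. Qed.

Lemma Hs_B : Q *: (cst B * Hs q A B) - Hs q A B * cst B = (Q - 1) *: Vs q A B.
Proof.
apply: trmx_inj; rewrite [in LHS]linearB [in LHS]linearZ [in RHS]linearZ /=.
rewrite (trmx_mulr (cst B) (Hs q A B)) (trmx_mulr (Hs q A B) (cst B)) trmx_cst.
rewrite -Hs_tr -Ws_tr.
exact: Hs_A (serreA_tr serreB) (serreB_tr serreA).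
Qed.

Lemma cf_Q1 k (U : 'M[fps R]_n.+1) : cf k ((Q - 1) *: U) = (q - 1) *: cf k U.
Proof. by rewrite (_ : Q - 1 = K (q - 1)) ?cfZ // KD KN. Qed.

Lemma cf_Qi1 k (U : 'M[fps R]_n.+1) : cf k ((1 - Qi) *: U) = (1 - q^-1) *: cf k U.
Proof. by rewrite (_ : 1 - Qi = K (1 - q^-1)) ?cfZ // KD KN. Qed.

Lemma br_g_g k l : br (g k) (g l) = 0.
Proof. by apply: br_gs_gs => //; apply: br_ps. Qed.

Lemma w_def k : (q - 1) *: w k = q *: (A * g k) - g k * A.
Proof.
by rewrite -cf_Q1 Ws_def // cfD cfN cfZ cf_cstl cf_cstr !cf_ser.
Qed.

Lemma v_def k : (q - 1) *: v k = q *: (g k * B) - B * g k.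
Proof.
by rewrite -cf_Q1 Vs_def // cfD cfN cfZ cf_cstl cf_cstr !cf_ser.
Qed.

Lemma w_def' k : (q - 1) *: w k = q *: (h k * A) - A * h k.
Proof.
by rewrite -cf_Q1 -Hs_A // cfD cfN cfZ cf_cstl cf_cstr.
Qed.

Lemma v_def' k : (q - 1) *: v k = q *: (B * h k) - h k * B.
Proof.
by rewrite -cf_Q1 -Hs_B // cfD cfN cfZ cf_cstl cf_cstr.
Qed.

Lemma h_def k : (1 - q^-1) *: (h k.+1 - g k.+1) = br A (v k).
Proof.
have := congr1 (cf k.+1) (Hs_Vs q0 qnr serreA serreB).
by rewrite cf_Qi1 cf_tS !cfD !cfN cf_cstl cf_cstr cf_ser.
Qed.

Lemma h0 : h 0 = 1.
Proof.
rewrite /h /Hs mulrDl -scalerAl cfD cf_t0 addr0 cfM big_ord1 !cf_ser.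
by rewrite gs0 mulr1.
Qed.

Lemma w0 : w 0 = A.
Proof. by rewrite /w cfM big_ord1 !cf_ser gs0 mulr1. Qed.

Lemma v0 : v 0 = B.
Proof. by rewrite /v cfM big_ord1 !cf_ser gs0 mul1r. Qed.

Lemma br_A_w k : br A (w k) = 0.
Proof.
have := congr1 (cf k) (br_A_Ws q0 qnr serreA serreB).
by rewrite cfD cfN cf_cstl cf_cstr cf0.
Qed.

Lemma qdet1 m : \sum_(i < m.+2) q ^- i *: (g i * h (m.+1 - i)%N) =
                \sum_(i < m.+1) q ^- i *: (w i * v (m - i)%N).
Proof.
have := congr1 (cf m.+1) (qdet_GH q0 qnr serreA serreB).
rewrite cfD cf1 add0r cf_tS !cfM.
under eq_bigr do rewrite cf_sub cf_ser exprVn -scalerAl.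
by under [in RHS]eq_bigr do rewrite cf_sub exprVn -scalerAl.
Qed.

Lemma qdet2 m : \sum_(i < m.+2) q ^- i *: (g (m.+1 - i)%N * h i) =
                \sum_(i < m.+1) q ^- i *: (v (m - i)%N * w i).
Proof.
have := congr1 (cf m.+1) (qdet_HG q0 qnr serreA serreB).
rewrite cfD cf1 add0r cf_tS !cfM (reindex_inj rev_ord_inj) /=.
rewrite [in RHS](reindex_inj rev_ord_inj) /=.
under eq_bigr => i _.
  rewrite subSS subKn; last by have := ltn_ord i; lia.
  rewrite cf_sub cf_ser exprVn -scalerAr; over.
under [in RHS]eq_bigr => i _.
  rewrite subSS subKn; last by have := ltn_ord i; lia.
  rewrite cf_sub exprVn -scalerAr; over.
by [].
Qed.

(* Commuting A past [g_k, g_l] = 0 turns one factor g into w; doing it twice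
   gives the relation between the w's. *)
Lemma br_w_w k l : br (w k) (w l) = 0.
Proof.
have Ag m : (q - 1) *: w m - (q *: (A * g m) - g m * A) = 0.
  by rewrite w_def subrr.
have Aw m : A * w m - w m * A = 0 by exact: br_A_w.
move: (Ag k) (Ag l) (Aw k) (Aw l) (br_g_g k l).
move: (w k) (w l) (g k) (g l) => wk wl gk gl.
set ek := _ - _; set el := _ - _; set fk := _ - _; set fl := _ - _ => k0 l0 fk0 fl0 gg.
pose Q1 := q *: (wk * gl) - gl * wk - q *: (wl * gk) + gk * wl.
have Q10 : (q - 1) *: Q1 = 0.
  transitivity (q ^+ 2 *: (A * br gk gl) - br gk gl * A
    + q *: (ek * gl) - gl * ek - q *: (el * gk) + gk * el).
    by rewrite /Q1 /ek /el /br; ncring.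
  by rewrite gg k0 l0 !(mulr0, mul0r, scaler0, subr0, addr0).
have {}Q10 : Q1 = 0 by apply: (scalerI q1); rewrite Q10 scaler0.
have : (q - 1) *: ((q + 1) *: br wk wl) = 0.
  transitivity (q *: (A * Q1) - Q1 * A + q *: (wk * el) - el * wk - q *: (wl * ek)
     + ek * wl - q ^+ 2 *: (fk * gl) + gl * fk + q ^+ 2 *: (fl * gk) - gk * fl).
    by rewrite /Q1 /ek /el /fk /fl /br; ncring.
  by rewrite Q10 k0 l0 fk0 fl0 !(mulr0, mul0r, scaler0, subr0, addr0).
move=> e; apply: (scalerI (q_add1_neq0 qnr)); apply: (scalerI q1).
by rewrite e !scaler0.
Qed.

End Coefficients.

(** The coefficient [c] is the q-integer [3] at a square root of [q]. *)
Definition serre (A B : 'M[R]_n.+1) : 'M[R]_n.+1 :=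
  let c := q + 1 + q^-1 in
  A ^+ 3 * B - c *: (A ^+ 2 * B * A) + c *: (A * B * A ^+ 2) - B * A ^+ 3.

Lemma serre_xs A B : serre A B = 0 -> xs q A B 1 * A = q *: (A * xs q A B 1).
Proof.
move=> e; apply/subr0_eq; transitivity ((kap q * q) *: serre A B).
  rewrite /serre /xs /= /dz /br /qc !exprS !expr0.
  by move: (kap q) => k; ncfield.
by rewrite e scaler0.
Qed.

Lemma serre_ys A B : serre B A = 0 -> B * ys q A B 1 = q *: (ys q A B 1 * B).
Proof.
move=> e; apply/subr0_eq; transitivity (- (kap q * q) *: serre B A).
  rewrite /serre /ys /= /dz /br /qc !exprS !expr0.
  by move: (kap q) => k; ncfield.
by rewrite e scaler0.
Qed.

Section Symmetric.
Variables A B : 'M[R]_n.+1.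
Hypotheses (trA : A^T = A) (trB : B^T = B).
Hypotheses (serreAB : serre A B = 0) (serreBA : serre B A = 0).
Let sA := serre_xs serreAB.
Let sB := serre_ys serreBA.
Let g k := gs q (ps q A B) k.
Let w k := cf k (Ws q A B).
Let v k := cf k (Vs q A B).
Let h k := cf k (Hs q A B).

Lemma altW_Ws k : altW q A B (- k%:Z) = w k /\ altW q A B k.+1%:Z = v k.
Proof.
have [] := @altE R q q0 qnr n A B g h w v (gs0 _ _) (h0 _ _) (w0 _ _) (v0 _ _)
  (qdet1 sA sB) (h_def sA sB) (w_def sA sB) (v_def sA sB) k.
by move=> -> ->.
Qed.

(* The transposed family satisfies the same recursion, with G and G~ swapped. *)
Lemma altW_Ws_tr k :
  altW q A B (- k%:Z) = (w k)^T /\ altW q A B k.+1%:Z = (v k)^T.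
Proof.
have [] // := @altE R q q0 qnr n A B (fun k => (h k)^T) (fun k => (g k)^T)
  (fun k => (w k)^T) (fun k => (v k)^T) _ _ _ _ _ _ _ _ k.
- by rewrite /h h0 trmx1.
- by rewrite /g gs0 trmx1.
- by rewrite /w w0.
- by rewrite /v v0.
- move=> m; have := congr1 trmx (qdet2 sA sB m); rewrite !linear_sum /=.
  under eq_bigr do rewrite linearZ /= trmx_mulr.
  by under [in RHS]eq_bigr do rewrite linearZ /= trmx_mulr.
- move=> m; apply: trmx_inj; have := h_def sA sB m.
  have -> : (br A (v m)^T)^T = - br A (v m).
    by rewrite /br linearB /= !trmx_mulr trmxK trA opprB.
  by move=> <-; rewrite linearZ /= linearB /= !trmxK -scalerN opprB.
- move=> m; apply: trmx_inj; have e := w_def' sA sB m.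
  by rewrite [in RHS]linearB !linearZ /= !trmx_mulr !trmxK trA.
- move=> m; apply: trmx_inj; have e := v_def' sA sB m.
  by rewrite [in RHS]linearB !linearZ /= !trmx_mulr !trmxK trB.
Qed.

Lemma altWN_sym k : (altW q A B (- k%:Z))^T = altW q A B (- k%:Z).
Proof. by rewrite {1}(altW_Ws k).1 (altW_Ws_tr k).1. Qed.

Lemma altWS_sym k : (altW q A B k.+1%:Z)^T = altW q A B k.+1%:Z.
Proof. by rewrite {1}(altW_Ws k).2 (altW_Ws_tr k).2. Qed.

Lemma altWN_comm k l :
  br (altW q A B (- k%:Z)) (altW q A B (- l%:Z)) = 0.
Proof. by rewrite !(altW_Ws _).1; apply: br_w_w. Qed.

(** The transposes of the v_k are the w_k of the pair (B^T, A^T), so [br_w_w] applies to that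
    pair. *)
Lemma altWS_comm k l : br (altW q A B k.+1%:Z) (altW q A B l.+1%:Z) = 0.
Proof.
rewrite (altW_Ws_tr k).2 (altW_Ws_tr l).2 /v -!cf_tr -(Ws_tr sA sB).
exact: br_w_w (serreA_tr sB) (serreB_tr sA) _ _.
Qed.

End Symmetric.
End SymmetricGenerators.

(** * Commuting symmetric matrices *)

Section SymmetricMatrices.
Variables (R : realType) (n : nat).
Implicit Types (M : 'M[R]_n.+1) (V U : {vspace 'cV[R]_n.+1}) (v : 'cV[R]_n.+1).

(** The spectral theorem over the complex numbers: M is Hermitian there, so its eigenvalues are real
    and the polynomial descends to [R]. *)
Lemma symmetric_annihilator M : M^T = M ->
  exists s : seq R, \prod_(a <- s) (M - a%:M) = 0.
Proof.
move=> trM; pose C := R[i]%C.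
pose f : R -> C := real_complex R.
pose Mc : 'M[C]_n.+1 := map_mx f M.
have realf a : f a \is Num.real.
  by apply/orP; case: (lerP 0 a) => a0; [left | right; move: (ltW a0)] => *;
     rewrite complex.lecE /= eqxx.
have herm : Mc \is hermsymmx.
  apply: realsym_hermsym; last by apply/mxOverP => i j; rewrite mxE.
  apply/is_hermitianmxP; rewrite expr0 scale1r map_mx_id //.
  by rewrite /Mc map_trmx trM.
have /orthomx_spectralP McE := hermitian_normalmx herm.
have real_d := hermitian_spectral_diag_real herm.
pose D := spectral_diag Mc.
exists [seq complex.Re (D 0 i) | i <- enum 'I_n.+1].
pose p : {poly R} := \prod_(i <- enum 'I_n.+1) ('X - (complex.Re (D 0 i))%:P).
have pE : map_poly f p = \prod_(i <- enum 'I_n.+1) ('X - (D 0 i)%:P).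
  rewrite /p rmorph_prod; apply: eq_bigr => i _.
  rewrite rmorphB /= map_polyX map_polyC /=; congr (_ - _%:P).
  by apply: complex.RRe_real; apply: (mxOverP real_d).
have p0 : horner_mx Mc (map_poly f p) = 0.
  have Pu : spectralmx Mc \is a GRing.unit := spectral_unit Mc.
  have -> : horner_mx Mc (map_poly f p) = _ := congr1 (horner_mx^~ _) McE.
  have := @horner_mx_uconj _ n (map_poly f p) (invmx (spectralmx Mc)) (diag_mx D).
  rewrite unitrV => /(_ Pu); rewrite invmxK => ->.
  rewrite horner_mx_diag; have -> : map_mx (horner (map_poly f p)) D = 0.
    apply/rowP => i; rewrite !mxE pE horner_prod.
    rewrite (bigD1_seq i) ?mem_enum ?enum_uniq //=.
    by rewrite hornerD hornerN hornerX hornerC subrr mul0r.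
  have -> : diag_mx 0 = 0 :> 'M[C]_n.+1.
    by apply/matrixP => i j; rewrite !mxE mul0rn.
  by rewrite mulmx0 mul0mx.
have : horner_mx M p = 0.
  by apply: (map_mx_inj (f := f)); rewrite map_horner_mx p0 map_mx0.
rewrite big_map => <-; rewrite /p rmorph_prod; apply: eq_bigr => i _.
by rewrite rmorphB /= horner_mx_X horner_mx_C.
Qed.

(** Apply the factors of an annihilating product to a vector of V one at a time: the last nonzero
    vector is an eigenvector in V. *)
Lemma symmetric_eigenvector M V : M^T = M ->
  (forall v, v \in V -> M *m v \in V) -> V <> 0%VS ->
  exists a v, [/\ v \in V, v != 0 & M *m v = a *: v].
Proof.
move=> trM MV V0; have [s s0] := symmetric_annihilator trM.
have [v vV v0] : exists2 v, v \in V & v != 0.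
  exists (vpick V); first exact: memv_pick.
  by rewrite vpick0; apply/eqP.
have {}s0 : \prod_(c <- s) (M - c%:M) *m v = 0 by rewrite s0 mul0mx.
elim: s s0 => [|a s IH].
  by rewrite big_nil mul1mx => e; rewrite e eqxx in v0.
rewrite big_cons -mulmxA mulmxBl mul_scalar_mx => /eqP; rewrite subr_eq0 => /eqP.
set w := _ *m v => e; have [/IH //|w0] := eqVneq w 0.
exists a, w; split=> //; rewrite /w.
elim: (s) => [|c l IHl]; first by rewrite big_nil mul1mx.
by rewrite big_cons -mulmxA mulmxBl mul_scalar_mx rpredB ?MV // rpredZ.
Qed.

Lemma mulmx_tr_eq0 v : v^T *m v = 0 -> v = 0.
Proof.
move/matrixP/(_ 0 0); rewrite !mxE => /eqP.
rewrite psumr_eq0 => [/allP v0|i _]; last by rewrite mxE -expr2 sqr_ge0.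
apply/colP => i; have := v0 i (mem_index_enum i).
by rewrite !mxE mulf_eq0 orbb => /eqP.
Qed.

Lemma orthogonal_cap0 U V : orthogonal_vspaces U V -> (U :&: V = 0)%VS.
Proof.
move=> UV; apply/eqP; rewrite -subv0; apply/subvP => v.
rewrite memv_cap memv0 => /andP[vU vV]; apply/eqP/mulmx_tr_eq0; exact: UV.
Qed.

Lemma dim_orthogonal_sum (S : seq {vspace 'cV[R]_n.+1}) : uniq S ->
  (forall U1 U2, U1 \in S -> U2 \in S -> U1 <> U2 -> orthogonal_vspaces U1 U2) ->
  \dim (\sum_(U <- S) U)%VS = (\sum_(U <- S) \dim U)%N.
Proof.
elim: S => [|U S IH] /=; first by rewrite !big_nil dimv0.
move=> /andP[US uS] orth; rewrite !big_cons dimv_disjoint_sum.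
  by rewrite IH // => U1 U2 h1 h2; apply: orth; rewrite inE ?h1 ?h2 orbT.
apply: orthogonal_cap0 => u v uU vS.
have {US} : forall W, W \in S -> orthogonal_vspaces U W.
  move=> W WS; apply: orth; rewrite ?inE ?eqxx ?WS ?orbT // => UW.
  by rewrite UW WS in US.
elim: S v vS {IH uS orth} => [|W S IH] v.
  by rewrite big_nil memv0 => /eqP -> _; rewrite mulmx0.
rewrite big_cons => /memv_addP[w wW [w' w'S ->]] orth.
rewrite mulmxDr (orth W) ?inE ?eqxx // add0r IH // => W' W'S.
by apply: orth; rewrite inE W'S orbT.
Qed.

(** Induction on dim V. If some F_k is not scalar on V and a is an eigenvalue of it there, the
    kernel and image of F_k - a on V are orthogonal by symmetry, span V, and are stable because the
    family commutes. *)
Lemma orthogonal_decomposition (F : nat -> 'M[R]_n.+1) V :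
  (forall k, (F k)^T = F k) -> (forall k l, F k *m F l = F l *m F k) ->
  (forall k v, v \in V -> F k *m v \in V) ->
  exists S : seq {vspace 'cV[R]_n.+1},
    [/\ uniq S, (forall U, U \in S <-> common_eigenspace F V U),
        V = (\sum_(U <- S) U)%VS
      & forall U1 U2, U1 \in S -> U2 \in S -> U1 <> U2 ->
          orthogonal_vspaces U1 U2].
Proof.
move=> trF commF; have [m] := ubnP (\dim V); elim: m V => // m IH V.
rewrite ltnS => dimV FV.
have subF U0 E : common_eigenspace F U0 E -> (E <= U0)%VS.
  by case=> _ [l El]; apply/subvP => v /El[].
have [V0|V0] := eqVneq V 0%VS.
  exists [::]; split=> //; last by rewrite big_nil.
  move=> U; split=> // UE; have := subF _ _ UE; case: UE => U0 _.
  by rewrite V0 subv0 => /eqP.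
have [scal|/existsNP[k nscal]] :=
    pselect (forall k, exists a, forall v, v \in V -> F k *m v = a *: v).
  have [l lE] := choice scal.
  exists [:: V]; split=> //; last 2 first.
  - by rewrite big_seq1.
  - by move=> U1 U2; rewrite !inE => /eqP -> /eqP ->.
  move=> U; rewrite inE; split=> [/eqP ->|UE].
    split; first exact/eqP.
    by exists l => v; split=> [vV|[]//]; split=> // j; apply: lE.
  have UV := subF _ _ UE; case: UE => U0 [l' Ul'].
  have [u uU u0] : exists2 u, u \in U & u != 0.
    by exists (vpick U); [apply: memv_pick | rewrite vpick0; apply/eqP].
  rewrite eqEsubv UV; apply/subvP => v vV; apply/Ul'; split=> // j.
  rewrite lE //; congr (_ *: _); have [uV /(_ j)] := (Ul' u).1 uU.
  rewrite lE // => /eqP; rewrite -subr_eq0 -scalerBl scaler_eq0 (negPf u0) orbF.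
  by rewrite subr_eq0 => /eqP.
have [a [v0 [v0V v00 v0E]]] := symmetric_eigenvector (trF k) (FV k) (elimN eqP V0).
pose f := linfun (mulmx (F k - a%:M)) : 'End('cV[R]_n.+1).
have fE v : f v = F k *m v - a *: v by rewrite lfunE /= mulmxBl mul_scalar_mx.
pose U := (V :&: lker f)%VS; pose U' := (f @: V)%VS.
have UP v : v \in U <-> v \in V /\ F k *m v = a *: v.
  rewrite memv_cap memv_ker fE subr_eq0; split=> [/andP[? /eqP]|[-> ->]] //.
  by rewrite eqxx.
have U'V : (U' <= V)%VS.
  apply/subvP => _ /memv_imgP[v vV ->]; rewrite fE rpredB ?FV //.
  exact: rpredZ.
have orth : orthogonal_vspaces U U'.
  move=> u _ /UP[uV ue] /memv_imgP[v vV ->]; rewrite fE mulmxBr mulmxA.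
  rewrite -{1}(trF k) -trmx_mul ue linearZ /= -scalemxAl scalemxAr.
  by rewrite subrr.
have cap0 := orthogonal_cap0 orth.
have sumV : (U + U')%VS = V.
  have dE : \dim (U + U') = \dim V by rewrite dimv_disjoint_sum // limg_ker_dim.
  by apply/eqP; rewrite eqEdim subv_add capvSl U'V dE leqnn.
have dimU : (0 < \dim U)%N.
  rewrite lt0n dimv_eq0; apply/eqP => U0; move: v00.
  by rewrite -memv0 -U0 => /negP; apply; apply/UP.
have dimU' : (0 < \dim U')%N.
  rewrite lt0n dimv_eq0; apply/eqP => U0; apply: nscal; exists a => v vV.
  apply/eqP; rewrite -subr_eq0 -fE -memv0 -U0; exact: memv_img.
have dimUU' : (\dim U + \dim U' = \dim V)%N by rewrite -dimv_disjoint_sum ?sumV.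
have FU j v : v \in U -> F j *m v \in U.
  move=> /UP[vV ve]; apply/UP; split; first exact: FV.
  by rewrite mulmxA commF -mulmxA ve scalemxAr.
have FU' j v : v \in U' -> F j *m v \in U'.
  move=> /memv_imgP[u uV ->].
  have -> : F j *m f u = f (F j *m u).
    by rewrite !fE mulmxBr mulmxA commF -mulmxA scalemxAr.
  by apply: memv_img; apply: FV.
have [|S1 [u1 S1E sum1 o1]] := IH U _ FU.
  by rewrite (leq_trans _ dimV) // -dimUU' -addn1 leq_add2l.
have [|S2 [u2 S2E sum2 o2]] := IH U' _ FU'.
  by rewrite (leq_trans _ dimV) // -dimUU' -add1n leq_add2r.
have nz (E : {vspace 'cV[R]_n.+1}) : E <> 0%VS -> exists2 e, e \in E & e != 0.
  by move/eqP => E0; exists (vpick E); [apply: memv_pick | rewrite vpick0].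
have eigU u l : u \in U -> u != 0 -> F k *m u = l *: u -> l = a.
  move=> /UP[_ ->] u0 /eqP; rewrite -subr_eq0 -scalerBl scaler_eq0 (negPf u0).
  by rewrite orbF subr_eq0 => /eqP.
have eigU' u l : u \in V -> F k *m u = l *: u -> l != a -> u \in U'.
  move=> uV ue la; have -> : u = f ((l - a)^-1 *: u).
    by rewrite linearZ /= fE ue -scalerBl scalerA mulVf ?scale1r ?subr_eq0.
  by apply: memv_img; apply: rpredZ.
have eigU'a u l : u \in U' -> u != 0 -> F k *m u = l *: u -> l != a.
  move=> uU' u0 ue; apply: contraNneq u0 => la; rewrite -memv0 -cap0 memv_cap uU'.
  by rewrite andbT; apply/UP; rewrite -la; split=> //; apply: (subvP U'V).
(* A common eigenspace of V lies in [U] or in [U'] according to whether its F_k-eigenvalue is [a],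
   so those of V are exactly those of the two summands. *)
exists (S1 ++ S2); split.
- rewrite cat_uniq u1 u2 andbT; apply/hasPn => E /S2E ES2; apply/negP => /S1E ES1.
  have [e eE] := nz E (proj1 ES1); rewrite -memv0 -cap0 memv_cap.
  by rewrite (subvP (subF _ _ ES1)) // (subvP (subF _ _ ES2)).
- move=> E; rewrite mem_cat; split=> [/orP[/S1E|/S2E] [E0 [l El]]|[E0 [l El]]].
  + split=> //; exists l => v; split=> [/El[/UP[vV _] ve] //|[vV ve]]; apply/El; split=> //.
    have [e /El[eU ee] e0] := nz E E0; apply/UP; split=> //.
    by rewrite ve (eigU e (l k)).
  + split=> //; exists l => v; split=> [/El[vU' ve]|[vV ve]].
      by split=> //; apply: (subvP U'V).
    have [e /El[eU' ee] e0] := nz E E0; apply/El; split=> //.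
    by apply: (eigU' v (l k)) => //; apply: (eigU'a e).
  + have [la|la] := eqVneq (l k) a; apply/orP; [left; apply/S1E | right; apply/S2E];
      split=> //; exists l => v; split.
    * by move=> /El[vV ve]; split=> //; apply/UP; rewrite -la.
    * by move=> [/UP[vV _] ve]; apply/El.
    * by move=> /El[vV ve]; split=> //; apply: (eigU' v (l k)).
    * by move=> [vU' ve]; apply/El; split=> //; apply: (subvP U'V).
- by rewrite big_cat /= -sum1 -sum2.
- have o12 U1 U2 : U1 \in S1 -> U2 \in S2 -> orthogonal_vspaces U1 U2.
    move=> /S1E/subF s1 /S2E/subF s2 u v uU vU.
    by apply: orth; [apply: (subvP s1) | apply: (subvP s2)].
  move=> U1 U2; rewrite !mem_cat => /orP[h1|h1] /orP[h2|h2] ne.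
  + exact: o1.
  + exact: o12.
  + by move=> u v uU vU; apply: trmx_inj; rewrite trmx_mul trmxK trmx0; apply: (o12 U2 U1).
  + exact: o2.
Qed.

Lemma orthogonal_sum_of_symmetric (F : nat -> 'M[R]_n.+1) V :
  (forall k, (F k)^T = F k) -> (forall k l, F k *m F l = F l *m F k) ->
  (forall k v, v \in V -> F k *m v \in V) ->
  orthogonal_sum_of_common_eigenspaces F V.
Proof.
move=> trF commF FV; have [S [uS SE sumS oS]] := orthogonal_decomposition trF commF FV.
exists S; split=> //; rewrite directvE /=; apply/eqP; exact: dim_orthogonal_sum.
Qed.

End SymmetricMatrices.

(** * Distance-regular graphs *)

Section GeometricSpectrum.
Variable b : int.
Hypotheses (b0 : b <> 0) (bN1 : b <> -1) (b1 : b <> 1).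

Lemma mulz_neq1 (u : int) : u * b <> 1.
Proof.
move=> /(congr1 absz); rewrite abszM => /eqP; rewrite muln_eq1 => /andP[_].
by case: b b0 bN1 b1 => [[|[|k]]|[|k]].
Qed.

Lemma exprz_root_of_unity k : (0 < k)%N -> b ^+ k != 1.
Proof.
by case: k => // k _; apply/eqP; rewrite exprSr; apply: mulz_neq1.
Qed.

Lemma exprz_inj i j : b ^+ i = b ^+ j -> i = j.
Proof.
wlog ij : i j / (i <= j)%N => [H|].
  by case: (leqP i j) => [/H //|/ltnW /H h] /esym /h.
have bi : b ^+ i != 0 by rewrite expf_neq0 //; apply/eqP.
rewrite -(subnKC ij) exprD -[LHS]mulr1 => /(mulfI bi) /esym/eqP.
have [->|k0] := posnP (j - i)%N; first by rewrite addn0.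
by rewrite (negPf (exprz_root_of_unity k0)).
Qed.

(** In nearly every ordering of the exponents, cancelling common powers of b from the first equation
    makes b a unit or a root of unity. One spurious solution remains, at b = -2, and the second
    equation excludes it. *)
Lemma geometric_shift m0 m1 m2 m3 : m0 <> m1 ->
  b * (b ^+ m1 - b ^+ m0) = b ^+ m2 - b ^+ m1 ->
  b * (b ^+ m2 - b ^+ m1) = b ^+ m3 - b ^+ m2 -> m1 = m0.+1.
Proof.
move=> m01 e1 e2.
have bx i : b ^+ i != 0 by rewrite expf_neq0 //; apply/eqP.
have [lt01|ge10] := ltnP m0 m1; last first.
  have [a m0E] : exists a, m0 = (m1 + a.+1)%N by exists (m0 - m1).-1; lia.
  have [lt21|ge12] := ltnP m2 m1.
    have [c m1E] : exists c, m1 = (m2 + c.+1)%N by exists (m1 - m2).-1; lia.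
    have : b ^+ m2 * ((b ^+ c * (b + 1) - b ^+ (c + a.+2)) * b) = b ^+ m2 * 1.
      rewrite mulr1; move: e1; rewrite m0E m1E => e1.
      apply/eqP; rewrite -subr_eq0; apply/eqP.
      transitivity (b * (b ^+ (m2 + c.+1) - b ^+ (m2 + c.+1 + a.+1)) -
          (b ^+ m2 - b ^+ (m2 + c.+1))); first by rewrite !(exprD, exprS); ring.
      by rewrite e1 subrr.
    by move=> /(mulfI (bx _)) /mulz_neq1.
  have [c m2E] : exists c, m2 = (m1 + c)%N by exists (m2 - m1)%N; lia.
  have e : b + 1 = b ^+ c + b ^+ a.+2.
    apply: (mulfI (bx m1)); move: e1; rewrite m0E m2E => e1.
    apply/eqP; rewrite -subr_eq0; apply/eqP.
    transitivity (b * (b ^+ m1 - b ^+ (m1 + a.+1)) - (b ^+ (m1 + c) - b ^+ m1)).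
      by rewrite !(exprD, exprS); ring.
    by rewrite e1 subrr.
  case: c e {m2E} => [|c] e.
    have : b ^+ a.+1 * b = 1 * b by move: e; rewrite expr0 -exprSr mul1r; lia.
    move/mulIf => /(_ (introN eqP b0)) /eqP.
    by rewrite (negPf (exprz_root_of_unity (ltn0Sn _))).
  have : (b ^+ c + b ^+ a.+1 - 1) * b = 1.
    by rewrite mulrBl mulrDl -!exprSr -e; ring.
  by move/mulz_neq1.
have [a m1E] : exists a, m1 = (m0 + a.+1)%N by exists (m1 - m0).-1; lia.
have [lt20|ge02] := ltnP m2 m0.
  have [c m0E] : exists c, m0 = (m2 + c.+1)%N by exists (m0 - m2).-1; lia.
  have : b ^+ m2 * ((b ^+ (c + a.+1) * (b + 1) - b ^+ c.+1) * b) = b ^+ m2 * 1.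
    rewrite mulr1; move: e1; rewrite m1E m0E => e1.
    apply/eqP; rewrite -subr_eq0; apply/eqP.
    transitivity (b * (b ^+ (m2 + c.+1 + a.+1) - b ^+ (m2 + c.+1)) -
        (b ^+ m2 - b ^+ (m2 + c.+1 + a.+1))); first by rewrite !(exprD, exprS); ring.
    by rewrite e1 subrr.
  by move=> /(mulfI (bx _)) /mulz_neq1.
have [c m2E] : exists c, m2 = (m0 + c)%N by exists (m2 - m0)%N; lia.
have e : b ^+ a.+1 * (b + 1) = b ^+ c + b.
  apply: (mulfI (bx m0)); move: e1; rewrite m1E m2E => e1.
  apply/eqP; rewrite -subr_eq0; apply/eqP.
  transitivity (b * (b ^+ (m0 + a.+1) - b ^+ m0) - (b ^+ (m0 + c) - b ^+ (m0 + a.+1))).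
    by rewrite !(exprD, exprS); ring.
  by rewrite e1 subrr.
case: a => [|a] in m1E e *; first by rewrite m1E addn1.
exfalso; case: c => [|c] in m2E e *.
  have : (b ^+ a.+1 * (b + 1) - 1) * b = 1.
    by move: e; rewrite expr0 [b ^+ a.+2]exprSr => e; move: e; lia.
  exact: mulz_neq1.
have {}e : b ^+ a.+1 * (b + 1) = b ^+ c + 1.
  apply: (mulfI (introN eqP b0)); transitivity (b ^+ a.+2 * (b + 1)); first by rewrite !exprS; ring.
  by rewrite e exprS; ring.
case: c => [|c] in m2E e *; last first.
  have : (b ^+ a * (b + 1) - b ^+ c) * b = 1.
    rewrite mulrBl -exprSr mulrAC -exprSr e; ring.
  exact: mulz_neq1.
(* Here b^(a+1) (b + 1) = 2. *)
have b2 : `|b|%N = 2%N.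
  have : (`|b| %| 2)%N.
    have := congr1 absz e; rewrite expr0 abszM exprS abszM => ee.
    by rewrite -[2%N]/(`|1 + 1 :> int|%N) -ee -mulnA dvdn_mulr.
  have := dvdn_leq (isT : 0 < 2)%N; move=> h /h; lia.
have bE : b = -2.
  have [//|] : b = -2 \/ b = 2 by lia.
  move=> bE; move: e; rewrite bE expr0 => e.
  have : (`|2 ^+ a.+1 * (2 + 1) : int|%N = 2)%N by rewrite e.
  rewrite exprS -mulrA abszM => h; have : (`|2 ^+ a * (2 + 1) : int| = 1)%N by lia.
  by rewrite abszM => /eqP; rewrite muln_eq1 andbF.
have a0 : a = 0%N.
  suff /exprz_inj [] : b ^+ a.+1 = b ^+ 1 by [].
  by move: e; rewrite expr0 expr1 bE; lia.
(* The spurious exponents m0, m0 + 2, m0 + 1 give values proportional to 1, 4, -2; the next value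
   would have to be 10, which is ruled out by its factor 5. *)
have e10 : (2 ^ m3 = 10 * 2 ^ m0)%N.
  have : b ^+ m3 = 10 * b ^+ m0.
    move: e2; rewrite m1E m2E a0 => e2.
    rewrite -[b ^+ m3](subrK (b ^+ (m0 + 1))) -e2 !exprD bE; ring.
  by move=> /(congr1 absz); rewrite bE abszM !abszX.
have : (5 %| 2 ^ m3)%N by rewrite e10 -[10%N]/(5 * 2)%N -mulnA dvdn_mulr.
by rewrite Euclid_dvdX.
Qed.

Variable R : realType.
Let q : R := b%:~R.

Lemma intr_neq0 : q != 0.
Proof. by rewrite intr_eq0; apply/eqP. Qed.

Lemma intr_root_of_unity k : (0 < k)%N -> q ^+ k != 1.
Proof.
move=> k0; rewrite /q -rmorphXn -[1]/(1%:~R) eqr_int.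
exact: exprz_root_of_unity.
Qed.

Lemma intr_exp_inj i j : q ^+ i = q ^+ j -> i = j.
Proof. by rewrite /q -!rmorphXn => /eqP; rewrite eqr_int => /eqP/exprz_inj. Qed.

(* For d = 2 and b = -2 this fails: 1, -1/2, 1/4 are in arithmetic progression,
   so a reflection permutes them. *)
Lemma geometric_spectrum_unique d (r s p t : R) : (3 <= d)%N -> r != 0 ->
  (forall i, (i <= d)%N ->
     exists2 j, (j <= d)%N & r * q ^- i + s = p * q ^- j + t) ->
  r = p /\ s = t.
Proof.
move=> d3 r0 rp; have qx i : q ^+ i != 0 by rewrite expf_neq0 ?intr_neq0.
(* With k = d - i, and after multiplication by q^d, all exponents are nonnegative, so the identities
   can be read in the integers. *)
have {rp} mE k : exists m, (k <= d)%N ->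
    (m <= d)%N /\ r * q ^+ k + s * q ^+ d = p * q ^+ m + t * q ^+ d.
  have [kd|] := leqP k d; last by exists 0%N.
  have [j jd e] := rp (d - k)%N (leq_subr _ _); exists (d - j)%N => _.
  split; first exact: leq_subr.
  have qk : q ^+ k = q ^- (d - k) * q ^+ d.
    have -> : q ^+ d = q ^+ (d - k) * q ^+ k by rewrite -exprD subnK.
    by rewrite mulKf.
  have qj : q ^+ (d - j) = q ^- j * q ^+ d.
    have -> : q ^+ d = q ^+ j * q ^+ (d - j) by rewrite -exprD subnKC.
    by rewrite mulKf.
  by rewrite qk qj !mulrA -!mulrDl e.
have [[m0 m0E] [m1 m1E] [m2 m2E] [m3 m3E]] := And4 (mE 0%N) (mE 1%N) (mE 2%N) (mE 3%N).
have [_ e0] := m0E isT; have [_ e1] := m1E (ltn_trans (isT : 0 < 2)%N d3).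
have [_ e2] := m2E (ltnW d3); have [_ e3] := m3E d3.
have q1 : q - 1 != 0 by rewrite subr_eq0 -[q]expr1 intr_root_of_unity.
have d01 : r * (q - 1) = p * (q ^+ m1 - q ^+ m0).
  rewrite expr0 in e0; rewrite expr1 in e1.
  have -> : r * (q - 1) = r * q + s * q ^+ d - (r * 1 + s * q ^+ d) by ring.
  by rewrite e0 e1; ring.
have d12 : r * (q * (q - 1)) = p * (q ^+ m2 - q ^+ m1).
  rewrite expr1 in e1.
  have -> : r * (q * (q - 1)) = r * q ^+ 2 + s * q ^+ d - (r * q + s * q ^+ d) by ring.
  by rewrite e2 e1; ring.
have d23 : r * (q ^+ 2 * (q - 1)) = p * (q ^+ m3 - q ^+ m2).
  have -> : r * (q ^+ 2 * (q - 1)) =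
    r * q ^+ 3 + s * q ^+ d - (r * q ^+ 2 + s * q ^+ d) by ring.
  by rewrite e3 e2; ring.
have p0 : p != 0.
  apply: contra_eq_neq d01 => ->; rewrite mul0r mulf_neq0 //.
have toZ i j k l : q * (q ^+ i - q ^+ j) = q ^+ k - q ^+ l ->
    b * (b ^+ i - b ^+ j) = b ^+ k - b ^+ l.
  rewrite /q -!rmorphXn -!rmorphB -rmorphM => /eqP.
  by rewrite eqr_int => /eqP.
have m10 : m1 = m0.+1.
  apply: (@geometric_shift m0 m1 m2 m3).
  - move=> m01; move/eqP: d01; rewrite m01 subrr mulr0 mulf_eq0 (negPf r0).
    by rewrite (negPf q1).
  - by apply: toZ; apply: (mulfI p0); rewrite mulrCA -d01 -d12; ring.
  - by apply: toZ; apply: (mulfI p0); rewrite mulrCA -d12 -d23; ring.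
have rE : r = p * q ^+ m0.
  by apply: (mulIf q1); rewrite d01 m10 exprS; ring.
have stE : s * q ^+ d = t * q ^+ d.
  by apply: (addrI (r * q ^+ 0)); rewrite e0 rE expr0 mulr1.
have st : s = t by apply: (mulIf (qx d)).
(* The top exponent d is sent to m0 + d, which may not exceed d; hence m0 = 0. *)
have [md mdE] := mE d; have [mdd ed] := mdE (leqnn _).
have : m0 + d = md.
  apply: intr_exp_inj; apply: (mulfI p0); rewrite exprD mulrA -rE.
  by apply: (addIr (s * q ^+ d)); rewrite ed st.
move=> m0d; have m00 : m0 = 0%N by lia.
by rewrite rE m00 expr0 mulr1.
Qed.

End GeometricSpectrum.

(** * Graph distance *)

Section Distance.
Variables (X : finType) (e : rel X).
Hypotheses (symE : symmetric e) (irrE : irreflexive e).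
Hypothesis conE : forall x y, connect e x y.

Lemma has_walkP k x y :
  reflect (exists p, [/\ path e x p, last x p = y & size p = k]) (has_walk e k x y).
Proof.
apply: (iffP existsP) => [[p /andP[ep /eqP lp]]|[p [ep lp sp]]].
  by exists p; rewrite size_tuple.
have sp' : size p == k by apply/eqP.
by exists (Tuple sp'); rewrite /= ep lp eqxx.
Qed.

(** A path without repeated vertices has fewer edges than there are vertices, so the search in
    [dist] succeeds. *)
Lemma dist_walk x y : has_walk e (dist e x y) x y.
Proof.
have [p ep lp] := connectP (conE x y).
have h : has (fun k => has_walk e k x y) (iota 0 #|X|).
  case/shortenP: ep lp => p' ep' up' _ lp'.
  apply/hasP; exists (size p').
    rewrite mem_iota add0n; have := max_card (mem (x :: p')).
    by rewrite (card_uniqP up').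
  by apply/has_walkP; exists p'.
have := nth_find 0%N h; rewrite nth_iota ?add0n //.
by rewrite -[X in (_ < X)%N](size_iota 0) -has_find.
Qed.

Lemma dist_le k x y : has_walk e k x y -> (dist e x y <= k)%N.
Proof.
move=> wk; rewrite leqNgt; apply/negP => kd.
have kX : (k < #|X|)%N.
  by apply: leq_trans kd _; rewrite -[X in (_ <= X)%N](size_iota 0) find_size.
by have := before_find 0%N kd; rewrite nth_iota // add0n wk.
Qed.

Lemma dist_eq0 x y : (dist e x y == 0%N) = (x == y).
Proof.
apply/eqP/eqP => [d0|->]; last first.
  by apply/eqP; rewrite -leqn0; apply: dist_le; apply/has_walkP; exists [::].
have /has_walkP[p [_ lp sp]] := dist_walk x y.
by move: sp; rewrite d0 -lp => /size0nil ->.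
Qed.

Lemma has_walk_sym k x y : has_walk e k x y -> has_walk e k y x.
Proof.
move=> /has_walkP[p [ep lp sp]]; apply/has_walkP; exists (rev (belast x p)).
split; last by rewrite size_rev size_belast.
  by rewrite -lp rev_path; under eq_path do rewrite symE.
by case: p {ep sp} lp => [|z p] //= lp; rewrite rev_cons last_rcons.
Qed.

Lemma dist_sym x y : dist e x y = dist e y x.
Proof.
by apply/eqP; rewrite eqn_leq !dist_le // has_walk_sym // dist_walk.
Qed.

Lemma dist_adj x y z : e y z -> (dist e x z <= (dist e x y).+1)%N.
Proof.
move=> eyz; apply: dist_le; have /has_walkP[p [ep lp sp]] := dist_walk x y.
apply/has_walkP; exists (rcons p z).
by rewrite rcons_path ep lp eyz last_rcons size_rcons sp.
Qed.

Lemma dist_diameter x y : (dist e x y <= diameter e)%N.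
Proof.
apply: leq_trans (leq_bigmax x); exact: (leq_bigmax (F := fun y => dist e x y)).
Qed.

Lemma dist1 x y : e x y -> dist e x y = 1%N.
Proof.
move=> exy; have := dist_adj x exy; have /eqP -> : dist e x x == 0%N by rewrite dist_eq0.
have : dist e x y != 0%N by rewrite dist_eq0; apply: contraTneq exy => ->; rewrite irrE.
by lia.
Qed.

End Distance.

Section HadamardProduct.
Variables (R : comNzRingType) (n : nat) (M : 'M[R]_n).
Definition hadm (N : 'M[R]_n) : 'M[R]_n := \matrix_(i, j) (M i j * N i j).
Fact hadm_linear : linear hadm.
Proof. by move=> c N1 N2; apply/matrixP => i j; rewrite !mxE; ring. Qed.
HB.instance Definition _ :=
  GRing.isLinear.Build R 'M[R]_n 'M[R]_n *:%R hadm hadm_linear.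
End HadamardProduct.

Lemma hadmC (R : comNzRingType) n (M N : 'M[R]_n) : hadm M N = hadm N M.
Proof. by apply/matrixP => i j; rewrite !mxE mulrC. Qed.

(** * Bose-Mesner algebra, primitive idempotents and the q-Serre relations *)

Section BoseMesner.
Variables (R : realType) (n : nat) (e : rel 'I_n.+1).
Hypotheses (symE : symmetric e) (irrE : irreflexive e).
Hypothesis conE : forall x y, connect e x y.
Variables c' b' : nat -> nat.
Hypothesis intE : intersection_numbers e c' b'.

Local Notation AA := (adj_mx R e).

Definition dist_mx (f : nat -> R) : 'M[R]_n.+1 := \matrix_(y, z) f (dist e y z).

Definition dist_op (f : nat -> R) i : R :=
  (c' i)%:R * f i.-1 + (b' i)%:R * f i.+1 + ((b' 0)%:R - (c' i)%:R - (b' i)%:R) * f i.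

Lemma dist_mx_tr f : (dist_mx f)^T = dist_mx f.
Proof. by apply/matrixP => y z; rewrite !mxE dist_sym. Qed.

Lemma adj_mx_tr : AA^T = AA.
Proof. by apply/matrixP => y z; rewrite !mxE symE. Qed.

Lemma degreeE y : #|[set w | e y w]| = b' 0.
Proof.
have [_] := intE y y; have /eqP -> : dist e y y == 0%N by rewrite dist_eq0.
move=> <-; apply: eq_card => w; rewrite !inE; case eyw: (e y w) => //=.
by rewrite dist1 // eqxx.
Qed.

Lemma natr_card (P : pred 'I_n.+1) : #|[set w | P w]|%:R = \sum_w (P w)%:R :> R.
Proof.
rewrite -sum1_card natr_sum big_mkcond /=; apply: eq_bigr => w _.
by rewrite inE; case: (P w).
Qed.

Lemma adj_dist_mx f : AA * dist_mx f = dist_mx (dist_op f).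
Proof.
apply/matrixP => y z; rewrite !mxE dist_sym //; set i := dist e z y.
have [cE bE] := intE z y; rewrite -/i in cE bE.
(* The counts become sums over w, so that the identity is checked for each neighbour separately. *)
rewrite /dist_op -cE -bE -(degreeE y) !natr_card !mulrBl !mulr_suml.
rewrite -!big_split -!sumrB -big_split; apply: eq_bigr => w _ /=.
rewrite !mxE dist_sym //; case eyw: (e y w); last by rewrite !mul0r; ring.
have h1 := dist_adj conE z eyw.
have h2 : (i <= (dist e z w).+1)%N by apply: dist_adj => //; rewrite symE.
rewrite -/i in h1 *; rewrite /= mul1r.
have [h|[h|h]] : (dist e z w).+1 = i \/ dist e z w = i \/ dist e z w = i.+1 by lia.
- have -> : (dist e z w == i.+1) = false by lia.
  by rewrite -h eqxx /=; ring.
- have -> : ((dist e z w).+1 == i) = false by lia.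
  have -> : (dist e z w == i.+1) = false by lia.
  by rewrite h /=; ring.
- have -> : ((dist e z w).+1 == i) = false by lia.
  by rewrite h eqxx /=; ring.
Qed.

Lemma dist_mx_comm f : AA * dist_mx f = dist_mx f * AA.
Proof.
have -> : dist_mx f * AA = (AA * dist_mx f)^T.
  by rewrite [RHS]trmx_mul adj_mx_tr dist_mx_tr.
by rewrite adj_dist_mx dist_mx_tr.
Qed.


Variables (d : nat) (b : int) (beta : R).
Hypotheses (b0 : b <> 0) (bN1 : b <> -1) (b1 : b <> 1).
Local Notation q := (b%:~R : R).
Hypothesis diamE : diameter e = d.
Hypothesis classE : forall i, (i <= d)%N ->
  (b' i)%:R = (bnum R b d - bnum R b i) * (beta - (q - 1) * bnum R b i) /\
  (c' i)%:R = bnum R b i * (1 + (q - 1) * bnum R b i.-1).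

Let q0 : q != 0 := intr_neq0 b0 R.
Let qnr k : (0 < k)%N -> q ^+ k != 1 := @intr_root_of_unity b b0 bN1 b1 R k.
Let q1 : q - 1 != 0.
Proof. by rewrite subr_eq0 -[X in X != _]expr1 qnr. Qed.
Let qx i : q ^+ i != 0. Proof. by rewrite expf_neq0. Qed.

Lemma bnumE j : bnum R b j = (q ^+ j - 1) / (q - 1).
Proof. by rewrite subrX1 mulrC mulKf // /bnum big_mkord. Qed.

(* With alpha = b - 1 the eigenvalues are affine in b^-i. *)
Definition theta_slope : R := q ^+ d * (beta + 1) / (q - 1).
Definition theta_const : R := - (q ^+ d + beta) / (q - 1).
Definition theta i : R := theta_slope * q ^- i + theta_const.

Lemma classical_eigenvalueE i : (i <= d)%N ->
  classical_eigenvalue d b (q - 1) beta i = theta i.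
Proof.
move=> id; rewrite /classical_eigenvalue /theta /theta_slope /theta_const !bnumE.
have -> : q ^+ d = q ^+ (d - i) * q ^+ i by rewrite -exprD subnK.
by field; rewrite q1 qx.
Qed.

(** The dual eigenvalues are affine in q^-i, so these entrywise powers span the polynomials in
    them. *)
Definition PX l : 'M[R]_n.+1 := dist_mx (fun i => q ^- i ^+ l).

Definition coefu j : R :=
  (- (q ^+ j - 1) / q - (q ^+ d + beta + 1) * (q ^- j - 1)) / (q - 1).
Definition coefw j : R := ((q ^+ j - 1) / q + (q ^- j - 1)) / (q - 1).

(** Triangularity of the adjacency matrix with diagonal entries theta_l. As coefu 0, coefw 0 and
    coefw 1 vanish, the truncated predecessors are harmless. *)
Lemma adj_PX l :
  AA * PX l = theta l *: PX l + coefu l *: PX l.-1 + coefw l *: PX l.-2.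
Proof.
rewrite adj_dist_mx; apply/matrixP => y z; rewrite !mxE.
have := dist_diameter e y z; rewrite diamE; move: (dist e y z) => i id.
have [bE cE] := classE id; have [b0E _] := classE (leq0n d).
rewrite /dist_op bE cE b0E !bnumE expr0.
have -> : q ^+ i.+1 = q ^+ i * q by rewrite exprSr.
have hu : coefu l * q ^- i ^+ l.-1 = coefu l * (q ^- i ^+ l * q ^+ i).
  case: l => [|l]; first by rewrite /coefu !expr0 invr1 !subrr oppr0 !(mul0r, mulr0) subrr !mul0r.
  by rewrite exprS [q ^- i * _]mulrC mulfVK.
have hw : coefw l * q ^- i ^+ l.-2 = coefw l * (q ^- i ^+ l * q ^+ i * q ^+ i).
  case: l {hu} => [|[|l]].
  - by rewrite /coefw !expr0 invr1 !subrr !(mul0r, mulr0) addr0 !mul0r.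
  - rewrite /coefw expr1; have -> : (q - 1) / q + (q^-1 - 1) = 0 by field.
    by rewrite !mul0r.
  - by rewrite !exprS /=; field.
rewrite hu hw invfM exprMn [q^-1 ^+ l]exprVn /theta /theta_slope /theta_const /coefu /coefw.
case: i id bE cE hu hw => [|i] id _ _ _ _.
  rewrite expr0 invr1 expr1n subrr !mul0r; field.
  by rewrite q1 q0 qx.
rewrite succnK; have -> : q ^- i ^+ l = q ^- i.+1 ^+ l * q ^+ l.
  by rewrite -exprMn exprS invfM mulrAC mulVf // mul1r.
move: (q ^- i.+1 ^+ l) => P; rewrite exprS; field.
by rewrite q1 q0 !qx.
Qed.

(** The degree filtration: entrywise polynomials of degree less than j in q^(-dist). *)
Definition W j : {vspace 'M[R]_n.+1} := <<[seq PX l | l <- iota 0 j]>>%VS.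

Lemma PX_W l j : (l < j)%N -> PX l \in W j.
Proof. by move=> lj; apply/memv_span/map_f; rewrite mem_iota. Qed.

Lemma W_lin (f : {linear 'M[R]_n.+1 -> 'M[R]_n.+1}) j (U : {vspace 'M[R]_n.+1}) :
  (forall l, (l < j)%N -> f (PX l) \in U) -> forall M, M \in W j -> f M \in U.
Proof.
move=> fU M MW; rewrite -(lfunE f) memv_preim.
have /subvP : (W j <= linfun f @^-1: U)%VS; last exact.
apply/span_subvP => ? /mapP[l]; rewrite mem_iota add0n => lj ->.
by rewrite -memv_preim lfunE; apply: fU.
Qed.

Lemma W_mono i j : (i <= j)%N -> forall M, M \in W i -> M \in W j.
Proof.
move=> ij M; apply: (@W_lin (idfun : {linear _ -> _})) => l li.
by apply: PX_W; lia.
Qed.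

Lemma W0 M : M \in W 0 -> M = 0.
Proof. by rewrite /W span_nil memv0 => /eqP. Qed.

Lemma W_tr j M : M \in W j -> M^T = M.
Proof.
move=> MW; apply/eqP; rewrite -subr_eq0 -memv0.
apply: (@W_lin (GRing.sub_fun trmx idfun) j) MW => l lj.
by rewrite /= dist_mx_tr subrr mem0v.
Qed.

Lemma W_comm j M : M \in W j -> GRing.comm AA M.
Proof.
move=> MW; apply/eqP; rewrite -subr_eq0 -memv0.
apply: (@W_lin (GRing.sub_fun (mulmx AA) (mulmxr AA)) j) MW => l lj.
by rewrite /= -[X in X - _]/(AA * PX l) dist_mx_comm subrr mem0v.
Qed.

Lemma adj_sub_W j M : M \in W j.+1 -> (AA - (theta j)%:M) * M \in W j.
Proof.
apply: (@W_lin (mulmx (AA - (theta j)%:M))) => l; rewrite ltnS => lj /=.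
have -> : (AA - (theta j)%:M) *m PX l = (theta l - theta j) *: PX l
    + (coefu l *: PX l.-1 + coefw l *: PX l.-2).
  rewrite mulmxBl mul_scalar_mx -[X in X - _]/(AA * PX l) adj_PX.
  by ncring.
have [ltlj|gejl] := ltnP l j; first by rewrite !rpredD ?rpredZ // PX_W //; lia.
have {lj gejl} -> : l = j by lia.
rewrite subrr scale0r add0r; case: j => [|j].
  rewrite /coefu /coefw expr0 invr1 !subrr oppr0 !(mul0r, mulr0) subrr addr0 !mul0r.
  by rewrite !scale0r addr0 mem0v.
by rewrite rpredD ?rpredZ // PX_W //; lia.
Qed.

Lemma adj_W j M : M \in W j -> AA * M \in W j.
Proof.
case: j => [|j] MW; first by rewrite (W0 MW) mulr0 mem0v.
have -> : AA * M = (AA - (theta j)%:M) * M + theta j *: M.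
  by rewrite mulrBl [X in _ - X]mul_scalar_mx subrK.
by rewrite rpredD ?rpredZ // (W_mono (leqnSn j)) // adj_sub_W.
Qed.

Lemma horner_W p j M : M \in W j -> horner_mx AA p * M \in W j.
Proof.
elim/poly_ind: p M => [|p c IH] M MW; first by rewrite rmorph0 mul0r mem0v.
rewrite rmorphD rmorphM /= horner_mx_X horner_mx_C mulrDl.
rewrite [X in _ + X]mul_scalar_mx rpredD ?rpredZ // -mulrA.
by apply: IH; apply: adj_W.
Qed.

(* Lagrange interpolation of the indicator function of distance 0. *)
Lemma one_W : 1 \in W d.+1.
Proof.
pose p : {poly R} := \prod_(i < d) ('X - (q ^- i.+1)%:P).
have p1 : p.[1] != 0.
  rewrite horner_prod; apply/prodf_neq0 => i _; rewrite !hornerE subr_eq0 eq_sym.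
  by rewrite invr_eq1 qnr.
have -> : 1 = p.[1]^-1 *: \sum_(l < d.+1) p`_l *: PX l.
  apply/matrixP => y z; rewrite !mxE summxE.
  under eq_bigr do rewrite !mxE.
  rewrite -horner_coef_wide; last first.
    by rewrite size_prod_XsubC [index_enum _]unlock -enumT size_enum_ord.
  have := dist_diameter e y z; rewrite diamE -(dist_eq0 conE).
  case: (dist e y z) => [|i] id; first by rewrite expr0 invr1 mulVf.
  have -> : p.[q ^- i.+1] = 0; last by rewrite mulr0.
  rewrite horner_prod (bigD1 (Ordinal id)) //= !hornerE subrr mul0r //.
by rewrite rpredZ // rpred_sum // => l _; rewrite rpredZ // PX_W.
Qed.

Lemma annihilator_W j M : M \in W j -> \prod_(l < j) (AA - (theta l)%:M) * M = 0.
Proof.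
elim: j M => [|j IH] M MW; first by rewrite (W0 MW) mulr0.
by rewrite big_ord_recr /= -mulrA IH // adj_sub_W.
Qed.

Definition theta_poly : {poly R} := \prod_(l < d.+1) ('X - (theta l)%:P).

Lemma horner_theta_poly : horner_mx AA theta_poly = 0.
Proof.
rewrite -[LHS]mulr1 rmorph_prod -[RHS](annihilator_W one_W); congr (_ * _).
by apply: eq_bigr => l _; rewrite rmorphB /= horner_mx_X horner_mx_C.
Qed.

Lemma root_adj_theta z : root (mxminpoly AA) z -> exists2 i, (i <= d)%N & z = theta i.
Proof.
move=> rz; have : root theta_poly z.
  rewrite -dvdp_XsubCl; apply: dvdp_trans (mxminpoly_min horner_theta_poly).
  by rewrite dvdp_XsubCl.
rewrite /root horner_prod => /prodf_eq0[i _].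
by rewrite !hornerE subr_eq0 => /eqP ->; exists i => //; rewrite -ltnS.
Qed.

Variables r s : R.
Hypotheses (d3 : (3 <= d)%N) (r0 : r != 0).
Hypothesis specA : forall z : R, root (mxminpoly AA) z <->
  exists2 i : nat, (i <= d)%N & z = r * q ^- i + s.

(** Each prescribed root is some theta_j, but the correspondence of indices is unknown;
    [geometric_spectrum_unique] settles it. *)
Lemma theta_rs : r = theta_slope /\ s = theta_const.
Proof.
apply: (geometric_spectrum_unique b0 bN1 b1 d3 r0) => i id.
have /root_adj_theta[j jd je] : root (mxminpoly AA) (r * q ^- i + s).
  by apply/specA; exists i.
by exists j.
Qed.

Lemma thetaE i : theta i = r * q ^- i + s.
Proof. by have [-> ->] := theta_rs. Qed.

Lemma theta_inj i j : i != j -> theta i - theta j != 0.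
Proof.
apply: contraNneq; rewrite !thetaE => /eqP; rewrite subr_eq0 => /eqP.
move=> /addIr /(mulfI r0) /invr_inj /(intr_exp_inj b0 bN1 b1) ->.
by rewrite eqxx.
Qed.

Definition lagrange i : {poly R} :=
  \prod_(l < d.+1 | (l : nat) != i) ((theta i - theta l)^-1 *: ('X - (theta l)%:P)).
Definition E i : 'M[R]_n.+1 := horner_mx AA (lagrange i).

Lemma lagrange_theta i j : (j <= d)%N -> (lagrange i).[theta j] = (i == j)%:R.
Proof.
move=> jd; rewrite horner_prod; have [->|ij] := eqVneq i j.
  rewrite big1 // => l lj; rewrite !hornerE mulVf // theta_inj //.
  by rewrite eq_sym.
have jd' : (j < d.+1)%N by [].
rewrite (bigD1 (Ordinal jd')) /=; last by rewrite eq_sym.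
by rewrite !hornerE subrr mulr0 mul0r.
Qed.

Lemma size_lagrange i : (i <= d)%N -> (size (lagrange i) <= d.+1)%N.
Proof.
move=> id; rewrite /lagrange scaler_prod (leq_trans (size_scale_leq _ _)) //.
rewrite -big_filter size_prod_XsubC size_filter -sum1_count.
rewrite (eq_bigl [in predC1 (Ordinal (id : i < d.+1)%N)]) => [|l].
  by rewrite sum1_card cardC1 card_ord.
by rewrite !inE -val_eqE.
Qed.

Lemma sum_lagrange : \sum_(i < d.+1) lagrange i = 1.
Proof.
apply/eqP; rewrite -subr_eq0; apply/eqP.
apply: (@roots_geq_poly_eq0 _ _ [seq theta i | i <- iota 0 d.+1]).
- apply/allP => ? /mapP[j]; rewrite mem_iota add0n ltnS => /= jd ->.
  rewrite /root !hornerE horner_sum (bigD1 (inord j)) //= lagrange_theta //.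
  rewrite inordK // eqxx big1 ?addr0 ?subrr // => i ij.
  rewrite lagrange_theta //; have -> : (i : nat) == j = false; last by [].
  by apply: contraNF ij => /eqP <-; rewrite inord_val.
- rewrite map_inj_in_uniq ?iota_uniq // => i j _ _ /eqP; apply: contraTeq => ij.
  by rewrite -subr_eq0 theta_inj.
rewrite size_map size_iota (leq_trans (size_polyD _ _)) // geq_max.
rewrite size_polyN size_poly1 andbT (leq_trans (size_sum _ _ _)) //.
by apply/bigmax_leqP => i _; apply: size_lagrange; rewrite -ltnS.
Qed.

Lemma sumE : \sum_(i < d.+1) E i = 1.
Proof. by rewrite -rmorph_sum sum_lagrange rmorph1. Qed.

Lemma E_comm i M : GRing.comm AA M -> GRing.comm (E i) M.
Proof. by move=> AM; apply: comm_horner_mx. Qed.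

Lemma adj_E i : (i <= d)%N -> AA * E i = theta i *: E i.
Proof.
move=> id; apply/eqP; rewrite -subr_eq0 -mul_scalar_mx -mulrBl.
have -> : AA - (theta i)%:M = horner_mx AA ('X - (theta i)%:P).
  by rewrite rmorphB /= horner_mx_X horner_mx_C.
rewrite /E -rmorphM /=.
have -> : ('X - (theta i)%:P) * lagrange i =
    (\prod_(l < d.+1 | (l : nat) != i) (theta i - theta l)^-1) *: theta_poly.
  rewrite /lagrange scaler_prod -scalerAr /theta_poly.
  rewrite [X in _ = _ *: X](bigD1 (Ordinal (id : i < d.+1)%N)) //=.
by rewrite -mul_polyC rmorphM /= horner_theta_poly mulr0.
Qed.

Lemma E_theta i M : (i <= d)%N -> E i * (AA * M) = theta i *: (E i * M).
Proof.
by move=> id; rewrite mulrA (E_comm i (commr_refl AA)) adj_E // scalerAl.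
Qed.

Lemma E_orth i j : (i <= d)%N -> (j <= d)%N -> i != j -> E i * E j = 0.
Proof.
move=> id jd ij; apply: (scalerI (theta_inj ij)).
by rewrite scaler0 scalerBl -E_theta // adj_E // -scalerAr subrr.
Qed.

Lemma E_idem i : (i <= d)%N -> E i * E i = E i.
Proof.
move=> id; rewrite -[RHS]mulr1 -sumE mulr_sumr.
rewrite (bigD1 (Ordinal (id : i < d.+1)%N)) //= big1 ?addr0 // => j ij.
have jd : (j <= d)%N by rewrite -ltnS.
by rewrite E_orth // eq_sym; apply: contraNneq ij => jE; apply/eqP/val_inj.
Qed.

Lemma E_shift i l M : (i <= d)%N ->
  E i * ((AA - (theta l)%:M) * M) = (theta i - theta l) *: (E i * M).
Proof.
move=> id; rewrite mulrBl mulrBr E_theta // scalerBl.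
by rewrite [X in _ - E i * X]mul_scalar_mx -scalerAr.
Qed.

(** A - theta_l lowers the filtration, while under E_i it acts as the nonzero scalar theta_i -
    theta_l; one descends to [W 0]. In [E_Wi] the same descent stops at [W i.+1]. *)
Lemma E_W0 i l M : (i <= d)%N -> (l <= i)%N -> M \in W l -> E i * M = 0.
Proof.
move=> id; elim: l M => [|l IH] M li MW; first by rewrite (W0 MW) mulr0.
have il : i != l by lia.
apply: (scalerI (theta_inj il)).
by rewrite scaler0 -E_shift // IH ?(ltnW li) // adj_sub_W.
Qed.

Lemma E_Wi i l M : (i <= d)%N -> M \in W l -> E i * M \in W i.+1.
Proof.
move=> id; elim: l M => [|l IH] M MW; first by rewrite (W0 MW) mulr0 mem0v.
have [li|il] := leqP l i; first by apply: horner_W; apply: W_mono MW.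
have ne : i != l by lia.
have -> : E i * M = (theta i - theta l)^-1 *: (E i * ((AA - (theta l)%:M) * M)).
  by rewrite E_shift // scalerA mulVf ?scale1r // theta_inj.
by rewrite rpredZ // IH // adj_sub_W.
Qed.

(** This is the Q-polynomial property. *)
Lemma E_W i : (i <= d)%N -> E i \in W i.+1.
Proof. by move=> id; rewrite -[E i]mulr1 (E_Wi id one_W). Qed.

Lemma E_tr i : (i <= d)%N -> (E i)^T = E i.
Proof. by move=> id; apply: W_tr (E_W id). Qed.

Lemma E_neq0 i : (i <= d)%N -> E i != 0.
Proof.
move=> id; apply/eqP => E0; have : root (lagrange i) (theta i).
  rewrite -dvdp_XsubCl; apply: dvdp_trans (mxminpoly_min E0).
  by rewrite dvdp_XsubCl; apply/specA; exists i => //; rewrite thetaE.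
by rewrite /root lagrange_theta // eqxx oner_eq0.
Qed.

Lemma W1P M : M \in W 1 -> exists c, M = c *: PX 0.
Proof. by rewrite /W span_seq1 => /vlineP. Qed.

Lemma W2P M : M \in W 2 -> exists c a, M = c *: PX 0 + a *: PX 1.
Proof.
rewrite /W /= span_cons span_seq1 => /memv_addP[_ /vlineP[c ->] [_ /vlineP[a ->] ->]].
by exists c, a.
Qed.

Lemma PX1_E : exists u v, PX 1 = u *: E 0 + v *: E 1.
Proof.
have [c0 E0E] := W1P (E_W (leq0n d)).
have d1 : (1 <= d)%N by apply: leq_trans d3.
have [c [a E1E]] := W2P (E_W d1).
have c00 : c0 != 0.
  by apply: contraNneq (E_neq0 (leq0n d)) => c00; rewrite E0E c00 scale0r.
have P0E : PX 0 = c0^-1 *: E 0 by rewrite E0E scalerA mulVf // scale1r.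
(* Otherwise E_1 would be a multiple of E_0, and E_1 = E_1 E_1 would vanish. *)
have a0 : a != 0.
  apply: contraNneq (E_neq0 d1) => a0.
  rewrite -(E_idem d1) [X in _ * X]E1E a0 scale0r addr0 P0E -!scalerAr.
  by rewrite E_orth // !scaler0.
exists (- (a^-1 * c * c0^-1)), a^-1; rewrite E1E P0E.
rewrite scalerDr !scalerA mulVf // scale1r scaleNr.
by rewrite addrA addNr add0r.
Qed.

Lemma PX1_sq : PX 1 * PX 1 \in W 2.
Proof.
have [u [v PE]] := PX1_E; have d1 : (1 <= d)%N by apply: leq_trans d3.
have -> : PX 1 * PX 1 = (u * u) *: E 0 + (v * v) *: E 1.
  rewrite PE mulrDl !mulrDr -!scalerAl -!scalerAr !scalerA.
  by rewrite !E_idem // !E_orth // !scaler0 addr0 add0r.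
by rewrite rpredD ?rpredZ ?(W_mono _ (E_W (leq0n d))) ?E_W.
Qed.

Lemma PX1_comm j M : M \in W j -> GRing.comm (PX 1) M.
Proof.
move=> MW; have [u [v ->]] := PX1_E; have AM := W_comm MW.
have ce k c : GRing.comm (c *: E k) M.
  by rewrite /GRing.comm -scalerAl -scalerAr (E_comm k AM).
by rewrite /GRing.comm mulrDl mulrDr !ce.
Qed.

Lemma hadm_W i j M N : M \in W i.+1 -> N \in W j.+1 -> hadm M N \in W (i + j).+1.
Proof.
move=> MW; apply: (@W_lin (hadm M)) => l lj /=; rewrite hadmC.
apply: (@W_lin (hadm (PX l))) MW => m mi /=.
have -> : hadm (PX l) (PX m) = PX (m + l).
  by apply/matrixP => y z; rewrite !mxE exprD mulrC.
by apply: PX_W; lia.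
Qed.

Variable x : 'I_n.+1.
(** The diagonal matrix of q^(-dist(x,y)); [dual_adj_mxE] shows that the dual adjacency matrix is r
    times it plus s. *)
Definition dual_mx : 'M[R]_n.+1 := diag_mx (row x (PX 1)).

Lemma mxtrace_tr_eq0 (M : 'M[R]_n.+1) : \tr (M *m M^T) = 0 -> M = 0.
Proof.
move=> /eqP; rewrite /mxtrace psumr_eq0 => [/allP t0|i _]; last first.
  by rewrite mxE sumr_ge0 // => j _; rewrite mxE -expr2 sqr_ge0.
apply/matrixP => i j; have /implyP := t0 i (mem_index_enum i).
rewrite mxE psumr_eq0 => [/(_ isT)/allP t1|k _]; last by rewrite mxE -expr2 sqr_ge0.
by have := t1 j (mem_index_enum j); rewrite !mxE mulf_eq0 orbb => /eqP.
Qed.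

(* The Krein parameter q^1_{ij} vanishes: E_i is orthogonal to E_1 o E_j, a
   polynomial of degree j + 1 in the dual eigenvalues. *)
Lemma E_dual_E0 i j : (i <= d)%N -> (j.+2 <= i)%N -> E i * dual_mx * E j = 0.
Proof.
move=> id ji; have jd : (j <= d)%N by lia.
apply: mxtrace_tr_eq0.
have trD : dual_mx^T = dual_mx by rewrite tr_diag_mx.
rewrite !trmx_mul trD !E_tr //.
rewrite -[X in \tr X]/(E i * dual_mx * E j * (E j * (dual_mx * E i))).
have -> : E i * dual_mx * E j * (E j * (dual_mx * E i)) =
    (E i * dual_mx * (E j * dual_mx)) * E i.
  by rewrite -!mulrA (mulrA (E j) (E j)) E_idem.
rewrite [X in \tr X]/(_ *m _) mxtrace_mulC -[X in \tr X]/(_ * _).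
rewrite !mulrA E_idem //.
pose N := hadm (E i) (E j).
have NW : N \in W (i + j).+1 by rewrite hadm_W ?E_W.
(* The squared norm of E_i D E_j is a quadratic form in the Hadamard product of E_i and E_j. *)
have -> : \tr (E i * dual_mx * E j * dual_mx) = (PX 1 * N * PX 1) x x.
  rewrite /mxtrace -mulrA; transitivity
    (\sum_y \sum_z E i y z * PX 1 x z * (E j z y * PX 1 x y)).
    apply: eq_bigr => y _; rewrite mxE; apply: eq_bigr => z _.
    by rewrite -![(_ * _ : 'M__) _ _]/((_ *m _) _ _) !mul_mx_diag !mxE.
  rewrite exchange_big mxE; apply: eq_bigr => z _.
  rewrite [(PX 1 * N) x z]mxE mulr_suml; apply: eq_bigr => y _.
  have -> : E j z y = E j y z by rewrite -[in LHS](E_tr jd) mxE.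
  have -> : PX 1 z x = PX 1 x z by rewrite !mxE dist_sym.
  by rewrite [N y z]mxE; ring.
(* Commuting [N] with [PX 1] joins the outer factors into a square lying in [W 2]; its Hadamard
   product with E_j lies in [W j.+2], which E_i kills. *)
rewrite (PX1_comm NW) -mulrA mxE.
have := E_W0 id ji; move=> /(_ (hadm (E j) (PX 1 * PX 1))) -e0.
have {e0} : E i * hadm (E j) (PX 1 * PX 1) = 0.
  by apply: e0; have := hadm_W (E_W jd) PX1_sq; rewrite addn1.
move=> /matrixP/(_ x x); rewrite [in LHS]mxE [in RHS]mxE => e1.
rewrite -[RHS]e1; apply: eq_bigr => y _.
have -> : N x y = E i x y * E j y x.
  by rewrite mxE -[in RHS](E_tr jd) [(E j)^T y x]mxE.
by rewrite [hadm _ _ y x]mxE mulrA.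
Qed.

Lemma E_dual_E i j : (i <= d)%N -> (j <= d)%N ->
  (i.+1 < j)%N || (j.+1 < i)%N -> E i * dual_mx * E j = 0.
Proof.
move=> id jd /orP[ij|ji]; last exact: E_dual_E0.
apply: trmx_inj; rewrite trmx0 !trmx_mul !E_tr // tr_diag_mx mulmxA.
exact: E_dual_E0.
Qed.

Local Notation Asub := (AA - s%:M).
Local Notation Dual := (r *: dual_mx).

(** As a cubic in u this has the roots v, q v and v/q, which correspond to j = i, i + 1 and i - 1 in
    some order. *)
Lemma qserre_factor (u v : R) (i j : nat) : ~~ ((i.+1 < j)%N || (j.+1 < i)%N) ->
  u = r * q ^- i -> v = r * q ^- j ->
  u ^+ 3 - (q + 1 + q^-1) * (u ^+ 2 * v) + (q + 1 + q^-1) * (u * v ^+ 2) - v ^+ 3 = 0.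
Proof.
move=> ij -> ->.
have -> : forall u v : R, u ^+ 3 - (q + 1 + q^-1) * (u ^+ 2 * v)
    + (q + 1 + q^-1) * (u * v ^+ 2) - v ^+ 3 = (u - v) * (u - q * v) * (u - q^-1 * v).
  by move=> a c; field.
have [h|[h|h]] : i = j \/ i = j.+1 \/ j = i.+1 by lia.
- by rewrite h subrr !mul0r.
- rewrite h exprS invfM [r * (q^-1 * _)]mulrCA; by rewrite subrr mulr0.
- by rewrite h exprS invfM [X in _ - q * X]mulrCA mulVKf // subrr mulr0 mul0r.
Qed.

Lemma serre_adj_dual : serre q Asub Dual = 0.
Proof.
have EA i : (i <= d)%N -> E i * Asub = (r * q ^- i) *: E i.
  move=> id; rewrite mulrBr (E_comm i (commr_refl AA)) adj_E // thetaE scalerDl.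
  by rewrite [E i * _]mul_mx_scalar addrK.
have AE i : (i <= d)%N -> Asub * E i = (r * q ^- i) *: E i.
  move=> id; rewrite mulrBl adj_E // thetaE scalerDl.
  by rewrite [_ * E i]mul_scalar_mx addrK.
rewrite -[LHS]mulr1 -[LHS]mul1r -sumE mulr_suml big1 // => i _.
rewrite mulr_sumr mulr_sumr big1 // => j _.
have id : (i <= d)%N by rewrite -ltnS.
have jd : (j <= d)%N by rewrite -ltnS.
have := EA i id; have := AE j jd; move: (E_dual_E id jd) (@qserre_factor (r * q ^- i) (r * q ^- j) i j).
move: (E i) (E j) (r * q ^- i) (r * q ^- j) => Ei Ej u v off fac AEj EAi.
have -> : Ei * (serre q Asub Dual * Ej) = (u ^+ 3 - (q + 1 + q^-1) * (u ^+ 2 * v)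
    + (q + 1 + q^-1) * (u * v ^+ 2) - v ^+ 3) *: (r *: (Ei * dual_mx * Ej)).
  have AEjX k : Asub ^+ k * Ej = v ^+ k *: Ej.
    elim: k => [|k IH]; first by rewrite !expr0 mul1r scale1r.
    by rewrite exprSr -mulrA AEj -scalerAr IH scalerA exprS.
  have EAiX k : Ei * Asub ^+ k = u ^+ k *: Ei.
    elim: k => [|k IH]; first by rewrite !expr0 mulr1 scale1r.
    by rewrite exprS mulrA EAi -scalerAl IH scalerA exprS.
  pose A1 := Asub ^+ 1; pose A2 := Asub ^+ 2; pose A3 := Asub ^+ 3.
  transitivity (Ei * A3 * Dual * Ej - (q + 1 + q^-1) *: (Ei * A2 * Dual * (A1 * Ej))
      + (q + 1 + q^-1) *: (Ei * A1 * Dual * (A2 * Ej)) - Ei * Dual * (A3 * Ej)).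
    rewrite /serre /A1 expr1 -/A2 -/A3; move: A2 A3 dual_mx Asub => A2' A3' D A1'.
    by ncring.
  rewrite !EAiX !AEjX; move: dual_mx => D; ncring.
case off_ij: ((i.+1 < j)%N || (j.+1 < i)%N); first by rewrite off // !scaler0.
by rewrite fac ?scale0r // off_ij.
Qed.

(** [Dual] is diagonal, so single entries take the place of the sandwich between idempotents, and
    adjacency bounds the difference of distances by 1. *)
Lemma serre_dual_adj : serre q Dual Asub = 0.
Proof.
pose w y := r * q ^- (dist e x y).
have Dl M y z : (Dual * M) y z = w y * M y z.
  rewrite -scalerAl mxE -[(_ * _ : 'M__) y z]/((dual_mx *m M) y z) mul_diag_mx !mxE.
  by rewrite mulrA expr1.
have Dr M y z : (M * Dual) y z = M y z * w z.
  rewrite -scalerAr mxE -[(_ * _ : 'M__) y z]/((M *m dual_mx) y z) mul_mx_diag !mxE.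
  by rewrite expr1 mulrCA mulrA.
apply/matrixP => y z.
have -> : serre q Dual Asub y z = (w y ^+ 3 - (q + 1 + q^-1) * (w y ^+ 2 * w z)
    + (q + 1 + q^-1) * (w y * w z ^+ 2) - w z ^+ 3) * Asub y z.
  transitivity ((Dual * (Dual * (Dual * Asub)) - (q + 1 + q^-1) *:
     (Dual * (Dual * Asub) * Dual) + (q + 1 + q^-1) *: (Dual * Asub * Dual * Dual)
     - Asub * Dual * Dual * Dual) y z).
    congr (fun_of_matrix _ y z); rewrite /serre !exprS !expr0.
    by move: dual_mx Asub => D A'; ncring.
  have entryD (M N : 'M[R]_n.+1) : (M + N) y z = M y z + N y z by rewrite mxE.
  have entryN (M : 'M[R]_n.+1) : (- M) y z = - M y z by rewrite mxE.
  have entryZ c (M : 'M[R]_n.+1) : (c *: M) y z = c * M y z by rewrite mxE.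
  by rewrite !(entryD, entryN, entryZ) !(Dl, Dr) !(entryD, entryN); ring.
rewrite [RHS]mxE; case far: (((dist e x y).+1 < dist e x z)%N || ((dist e x z).+1 < dist e x y)%N).
  have -> : Asub y z = 0; last by rewrite mulr0.
  rewrite !mxE; have [yz|_] := eqVneq y z; first by move: far; rewrite yz; lia.
  case eyz: (e y z); last by rewrite mulr0n subrr.
  have h1 := dist_adj conE x eyz.
  have h2 : (dist e x y <= (dist e x z).+1)%N by apply: dist_adj => //; rewrite symE.
  by move: far; lia.
by rewrite (@qserre_factor _ _ (dist e x y) (dist e x z)) ?mul0r // far.
Qed.

(** The rows of E_i span the eigenspace, and those of 1 - E_i lie in its orthogonal complement. *)
Lemma primitive_idempotentE i : (i <= d)%N ->
  primitive_idempotent AA (theta i) = E i.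
Proof.
move=> id; rewrite /primitive_idempotent; set U := eigenspace _ _.
have UE : U *m E i = U.
  have UA : U *m AA = theta i *: U by apply/eigenspaceP.
  have Uj j : (j <= d)%N -> j != i -> U *m E j = 0.
    move=> jd ji; apply: (scalerI (theta_inj ji)); rewrite scaler0 scalerBl.
    have <- : U *m (AA *m E j) = theta i *: (U *m E j).
      by rewrite mulmxA UA -scalemxAl.
    by rewrite -[AA *m E j]/(AA * E j) adj_E // scalemxAr subrr.
  rewrite -[RHS]mulmx1 -[1%:M]/(1 : 'M[R]_n.+1) -sumE mulmx_sumr.
  rewrite (bigD1 (Ordinal (id : i < d.+1)%N)) //= big1 ?addr0 // => j ij.
  apply: Uj; first by rewrite -ltnS.
  by apply: contraNneq ij => jE; apply/eqP/val_inj.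
have EU : (E i <= U)%MS.
  by apply/eigenspaceP; rewrite -adj_E //; apply: (E_comm i (commr_refl AA)).
have FU : (1%:M - E i <= kermx U^T)%MS.
  apply/sub_kermxP; rewrite -{1}UE trmx_mul E_tr // mulmxA mulmxBl mul1mx.
  by rewrite -[X in _ - X]/(E i * E i) E_idem // subrr mul0mx.
have cap0 : (U :&: kermx U^T)%MS = 0.
  apply/eqP; rewrite -submx0; apply/row_subP => k.
  set v := row k _.
  have /submxP[u vU] : (v <= U)%MS by apply: submx_trans (row_sub _ _) (capmxSl _ _).
  have /sub_kermxP vK : (v <= kermx U^T)%MS.
    by apply: submx_trans (row_sub _ _) (capmxSr _ _).
  suff -> : v = 0 by rewrite sub0mx.
  apply: trmx_inj; rewrite trmx0; apply: mulmx_tr_eq0.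
  by rewrite trmxK {2}vU trmx_mul mulmxA vK mul0mx.
have e1 : E i *m proj_mx U (kermx U^T) = E i by apply: proj_mx_id.
have e2 : (1%:M - E i) *m proj_mx U (kermx U^T) = 0 by apply: proj_mx_0.
rewrite -[LHS]mul1mx -[1%:M](subrK (E i)) mulmxDl e1 e2 add0r //.
Qed.

Hypothesis specD : forall z : R,
  root (mxminpoly (dual_adj_mx e d b (q - 1) beta x)) z <->
  exists2 i : nat, (i <= d)%N & z = r * q ^- i + s.

(** E_1 lies in [W 2], so the diagonal entries are affine in q^(-dist) with unknown coefficients;
    comparison with the prescribed roots forces these to be r and s. *)
Lemma dual_adj_mxE : dual_adj_mx e d b (q - 1) beta x = Dual + s%:M.
Proof.
have d1 : (1 <= d)%N by apply: leq_trans d3.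
have [c [a E1E]] := W2P (E_W d1).
pose p := n.+1%:R * a; pose t := n.+1%:R * c.
pose f y : R := p * q ^- dist e x y + t.
have DE : dual_adj_mx e d b (q - 1) beta x = diag_mx (\row_y f y).
  rewrite /dual_adj_mx classical_eigenvalueE // primitive_idempotentE // E1E.
  congr diag_mx; apply/rowP => y; rewrite !mxE expr0 expr1 /f /p /t; ring.
have [rp st] : r = p /\ s = t.
  apply: (geometric_spectrum_unique b0 bN1 b1 d3 r0) => i id.
  have : root (mxminpoly (diag_mx (\row_y f y))) (r * q ^- i + s).
    by rewrite -DE; apply/specD; exists i.
  have ann : horner_mx (diag_mx (\row_y f y)) (\prod_y ('X - (f y)%:P)) = 0.
    rewrite horner_mx_diag; apply/matrixP => y z; rewrite !mxE horner_prod.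
    by rewrite (bigD1 y) //= !hornerE subrr mul0r mul0rn.
  rewrite -dvdp_XsubCl => /dvdp_trans /(_ (mxminpoly_min ann)).
  rewrite dvdp_XsubCl /root horner_prod => /prodf_eq0[y _].
  rewrite !hornerE subr_eq0 => /eqP ->; exists (dist e x y) => //.
  by rewrite -diamE dist_diameter.
rewrite DE; apply/matrixP => y z; rewrite !mxE expr1 /f -rp -st.
by case: (y == z); rewrite ?mulr1n ?mulr0n ?mulr0 ?addr0.
Qed.

End BoseMesner.

(** * Action of the alternating elements on modules *)

Lemma altW_generated (R : realType) n (q : R) (A As : 'M[R]_n.+1) m :
  altW q A As (- m%:Z) \in generated_algebra A As /\
  altW q A As m.+1%:Z \in generated_algebra A As.
Proof.
set T := generated_algebra A As.
have TA : A \in T.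
  by apply: (subvP (sub_agenv _)); apply: memv_span; rewrite inE eqxx.
have TAs : As \in T.
  by apply: (subvP (sub_agenv _)); apply: memv_span; rewrite !inE eqxx orbT.
have T1 : 1 \in T by rewrite memvE; apply: sub1_agenv.
have TM M N : M \in T -> N \in T -> M * N \in T by apply: memvM.
have TC M N : M \in T -> N \in T -> comm_mx2 M N \in T.
  by move=> MT NT; rewrite rpredB ?TM.
have TQ M N : M \in T -> N \in T -> qcomm_mx2 q M N \in T.
  by move=> MT NT; rewrite rpredB ?rpredZ ?TM.
suff H k : [/\ altW q A As (- k%:Z) \in T, altW q A As k.+1%:Z \in T,
               altG q A As k \in T & altH q A As k \in T] by case: (H m).
elim/ltn_ind: k => -[|k] IH; first by rewrite oppr0 altW0 altW1 altG0 altH0.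
have WN l : (l <= k)%N -> altW q A As (- l%:Z) \in T by case/IH.
have WP l : (l <= k)%N -> altW q A As l.+1%:Z \in T by case/IH.
have TG : altG q A As k.+1 \in T.
  rewrite altGE // rpredD ?rpredZ ?TC ?WP //.
  rewrite rpredB // big_nat rpred_sum // => l /andP[l0 lk]; rewrite rpredZ ?TM //.
  - exact: WN.
  - have -> : k.+1%:Z - l%:Z = (k - l).+1%:Z by lia.
    by apply: WP; lia.
  - by case: (IH l lk).
  - by have [|] := IH (k.+1 - l)%N; first by lia.
have TH : altH q A As k.+1 \in T by rewrite altHE // rpredD ?rpredZ ?TC ?WP.
by rewrite TG TH altWNE // altWSE // altW1 !rpredZ ?TQ.
Qed.

Theorem theorem11p6 (R : realType) (n : nat) (e : rel 'I_n.+1)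
    (d : nat) (b : int) (alpha beta : R) (x : 'I_n.+1) (r s : R) :
  distance_regular e ->
  (3 <= d)%N ->
  classical_parameters e d b alpha beta ->
  b <> 0 -> b <> -1 -> b <> 1 ->
  alpha = b%:~R - 1 ->
  let q : R := b%:~R in
  let AA := adj_mx R e in
  let AAs := dual_adj_mx e d b alpha beta x in
  r <> 0 ->
  (forall z : R, root (mxminpoly AA) z <->
     exists2 i : nat, (i <= d)%N & z = r * q ^- i + s) ->
  (forall z : R, root (mxminpoly AAs) z <->
     exists2 i : nat, (i <= d)%N & z = r * q ^- i + s) ->
  let A := AA - s%:M in
  let As := AAs - s%:M in
  forall V : {vspace 'cV[R]_n.+1},
    irreducible_module (generated_algebra A As) V ->
    orthogonal_sum_of_common_eigenspaces
      (fun k : nat => altW q A As (- k%:Z)) V /\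
    orthogonal_sum_of_common_eigenspaces
      (fun k : nat => altW q A As k.+1%:Z) V.
Proof.
move=> [symE irrE conE _] d3 [diamE [c' [b' [intE classE]]]] b0 bN1 b1 alphaE.
move=> q AA AAs /eqP r0 specA specD A As V [modV _ _].
have {}classE i : (i <= d)%N ->
    (b' i)%:R = (bnum R b d - bnum R b i) * (beta - (q - 1) * bnum R b i) /\
    (c' i)%:R = bnum R b i * (1 + (q - 1) * bnum R b i.-1).
  by rewrite -alphaE => /classE[].
have q0 : q != 0 := intr_neq0 b0 R.
have qnr k : (0 < k)%N -> q ^+ k != 1 := @intr_root_of_unity b b0 bN1 b1 R k.
have AsE : As = r *: dual_mx R e b x.
  rewrite /As /AAs alphaE.
  rewrite (dual_adj_mxE symE irrE conE intE b0 bN1 b1 diamE classE d3 r0 specA).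
    by rewrite addrK.
  by rewrite -alphaE.
have s1 : serre q A As = 0.
  rewrite AsE.
  exact: (serre_adj_dual symE irrE conE intE b0 bN1 b1 diamE classE d3 r0 specA).
have s2 : serre q As A = 0.
  rewrite AsE.
  exact: (serre_dual_adj symE conE b0 bN1 b1 diamE s d3 r0 x).
have trA : A^T = A by rewrite linearB /= adj_mx_tr // tr_scalar_mx.
have trAs : As^T = As by rewrite AsE linearZ /= tr_diag_mx.
have VN k v : v \in V -> altW q A As (- k%:Z) *m v \in V.
  by apply: modV; have [] := altW_generated q A As k.
have VP k v : v \in V -> altW q A As k.+1%:Z *m v \in V.
  by apply: modV; have [] := altW_generated q A As k.
split; apply: orthogonal_sum_of_symmetric.
- exact: (altWN_sym q0 qnr trA trAs s1 s2).
- by move=> k l; apply/subr0_eq; apply: (altWN_comm q0 qnr s1 s2).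
- exact: VN.
- exact: (altWS_sym q0 qnr trA trAs s1 s2).
- by move=> k l; apply/subr0_eq; apply: (altWS_comm q0 qnr trA trAs s1 s2).
- exact: VP.
Qed.
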